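(* The following linear map is a Hopf algebra automorphism: $$\Theta:(\mathcal{H}_{\mathbf{QP}},m,\Delta)\to(\mathcal{H}_{\mathbf{QP}},m,\Delta),\qquad P\mapsto\sum_{\sim\triangleleft P}P/\sim.$$ Its inverse is $$\Theta^{-1}:\ P\mapsto\sum_{\sim\triangleleft P}(-1)^{cl(P)+cl(\sim)}P/\sim.$$ Moreover, $EHR^{str}\circ\Theta=EHR$ and $EHR\circ\Theta^{-1}=EHR^{str}$.
   Context: $\mathbb{K}$ is a field of characteristic zero, $[n]=\{1,\ldots,n\}$. $\mathbf{QP}(n)$ is the set of quasi-posets $P=([n],\leq_P)$ ($\leq_P$ reflexive and transitive), $\mathbf{QP}=\bigsqcup_{n\geq0}\mathbf{QP}(n)$; $i\sim_Pj$ means $i\leq_Pj$ and $j\leq_Pi$; $cl(P)$ is the number of $\sim_P$-classes. $top(P)$ is the topology of subsets $O$ with ($i\in O$, $i\leq_Pj$)$\Rightarrow j\in O$; $P$ is connected if this topology is connected. For an equivalence $\sim$ on $[n]$, $cl(\sim)$ is its number of classes, and $P/\sim\in\mathbf{QP}(n)$ has quasi-order $\leq_{P/\sim}$ the transitive closure of the relation ($x\leq_Py$ or $x\sim y$). We write $\sim\triangleleft P$ if the restriction of $P$ to each class of $\sim$ is connected and $\sim_{P/\sim}$ equals $\sim$. For a quasi-poset on a subset of $\mathbb{N}$ with $n$ elements, $Std$ denotes its transport to $[n]$ by the increasing bijection. $\mathcal{H}_{\mathbf{QP}}$ is the $\mathbb{K}$-vector space with basis $\mathbf{QP}$; it is a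 Hopf algebra with product $m$: for $P\in\mathbf{QP}(k)$, $Q\in\mathbf{QP}(l)$, $PQ\in\mathbf{QP}(k+l)$ is the disjoint union of $P$ on $[k]$ and $Q$ shifted by $k$ on $\{k+1,\ldots,k+l\}$; and coproduct $\Delta(P)=\sum_{O\in top(P)}Std(P_{\mid[n]\setminus O})\otimes Std(P_{\mid O})$ for $P\in \mathbf{QP}(n)$. A packed word of length $n$ is a word $w=w_1\ldots w_n$ in positive integers with $\{w_1,\ldots,w_n\}=[k]$ for some $k\geq0$; it is identified with the map $i\mapsto w(i)=w_i$. $\mathbf{WQSym}$ is the $\mathbb{K}$-vector space with basis the packed words. For $P\in\mathbf{QP}(n)$, $W_P$ is the set of packed words $w$ of length $n$ such that $i\leq_Pj\Rightarrow w(i)\leq w(j)$; $W^{str}_P$ is the set of $w\in W_P$ such that ($i\leq_Pj$ and $w(i)=w(j)$) implies $i\sim_Pj$. $EHR,EHR^{str}:\mathcal{H}_{\mathbf{QP}}\to\mathbf{WQSym}$ are the linear maps $EHR(P)=\sum_{w\in W_P}w$, $EHR^{str}(P)=\sum_{w\in W_P^{str}}w$. *)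

(* Defs.v *)
From HB Require Import structures.
From mathcomp Require Import all_boot all_order all_algebra finmap.
From mathcomp.multinomials Require Import monalg.

Set Implicit Arguments.
Unset Strict Implicit.
Unset Printing Implicit Defensive.

Import GRing.Theory.

Local Open Scope ring_scope.

Section QuasiPosets.

(* The underlying set [n] = {1, ..., n} is encoded as 'I_n = {0, ..., n - 1}. *)
Definition is_qorder n (R : {set 'I_n * 'I_n}) : bool :=
  [forall i, (i, i) \in R] &&
  [forall i, forall j, forall k,
    ((i, j) \in R) ==> ((j, k) \in R) ==> ((i, k) \in R)].

Record qposet (n : nat) : Type :=
  QPoset { qgraph : {set 'I_n * 'I_n}; qgraphP : is_qorder qgraph }.

HB.instance Definition _ n := [isSub for @qgraph n].
HB.instance Definition _ n := [Finite of qposet n by <:].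

Definition qle n (P : qposet n) : rel 'I_n := fun i j => (i, j) \in qgraph P.

Lemma qle_refl n (P : qposet n) : reflexive (qle P).
Proof. by move=> i; have /andP[/forallP RR _] := qgraphP P; apply: RR. Qed.

Lemma qle_trans n (P : qposet n) : transitive (qle P).
Proof.
move=> j i k; have /andP[_ /forallP RT] := qgraphP P.
by move: (RT i) => /forallP/(_ j)/forallP/(_ k)/implyP H /H/implyP.
Qed.

Fact mk_qposet_subproof n (r : rel 'I_n) :
  reflexive r -> transitive r -> is_qorder [set p | r p.1 p.2].
Proof.
move=> rr rt; apply/andP; split; first by apply/forallP => i; rewrite inE.
do 3![apply/forallP => ?]; rewrite !inE /=.
by apply/implyP => ij; apply/implyP; apply: rt.
Qed.

Definition mk_qposet n (r : rel 'I_n) (rr : reflexive r) (rt : transitive r) :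
  qposet n := QPoset (mk_qposet_subproof rr rt).

Lemma qle_mk n (r : rel 'I_n) (rr : reflexive r) (rt : transitive r) :
  qle (mk_qposet rr rt) =2 r.
Proof. by move=> i j; rewrite /qle inE. Qed.

Definition QP : Type := {n : nat & qposet n}.
HB.instance Definition _ := Choice.on QP.

Definition qp n (P : qposet n) : QP := Tagged qposet P.

Lemma qp_eq n m (P : qposet n) (Q : qposet m) : n = m ->
  (forall (i j : 'I_n) (i' j' : 'I_m), i = i' :> nat -> j = j' :> nat ->
    qle P i j = qle Q i' j') -> qp P = qp Q.
Proof.
move=> nm; move: Q; rewrite -{m}nm => Q PQ; congr (qp _).
by apply/val_inj/setP => -[i j]; apply: PQ.
Qed.

Definition qsim n (P : qposet n) : rel 'I_n := fun i j => qle P i j && qle P j i.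

Definition ncl n (r : rel 'I_n) : nat := #|equivalence_partition r [set: 'I_n]|.

Definition is_open n (P : qposet n) (O : {set 'I_n}) : bool :=
  [forall i, forall j, (i \in O) ==> qle P i j ==> (j \in O)].

Definition top n (P : qposet n) : {set {set 'I_n}} := [set O | is_open P O].

Definition qconnected n (P : qposet n) : bool :=
  ~~ [exists O1 in top P, exists O2 in top P,
       [&& O1 != set0, O2 != set0, [disjoint O1 & O2] & O1 :|: O2 == setT]].

(* Std(P_|A): enum_val : 'I_#|A| -> 'I_n enumerates A increasingly. *)
Definition qstd n (P : qposet n) (A : {set 'I_n}) : qposet #|A| :=
  mk_qposet (r := fun i j => qle P (enum_val i) (enum_val j))
    (fun i => qle_refl P (enum_val i))
    (fun j i k => @qle_trans n P (enum_val j) (enum_val i) (enum_val k)).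

(* An equivalence on [n] is a quasi-poset whose quasi-order is symmetric. *)
Definition is_equiv n (E : qposet n) : bool :=
  [forall i, forall j, qle E i j ==> qle E j i].

(* [connect r] is the reflexive transitive closure of r; here r is reflexive. *)
Definition qquot n (P E : qposet n) : qposet n :=
  let r : rel 'I_n := fun x y => qle P x y || qle E x y in
  mk_qposet (r := connect r) (@connect0 _ r) (@connect_trans _ r).

Definition triangle n (E P : qposet n) : bool :=
  [forall C in equivalence_partition (qle E) [set: 'I_n],
     qconnected (qstd P C)] &&
  [forall i, forall j, qsim (qquot P E) i j == qle E i j].

Definition qsum_rel k l (P : qposet k) (Q : qposet l) : rel 'I_(k + l) :=
  fun i j => match split i, split j with
             | inl a, inl b => qle P a b
             | inr a, inr b => qle Q a b
             | _, _ => false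
             end.

Fact qsum_refl k l (P : qposet k) (Q : qposet l) : reflexive (qsum_rel P Q).
Proof. by move=> i; rewrite /qsum_rel; case: split => a; apply: qle_refl. Qed.

Fact qsum_trans k l (P : qposet k) (Q : qposet l) : transitive (qsum_rel P Q).
Proof.
move=> j i h; rewrite /qsum_rel.
by case: (split i) => a; case: (split j) => b; case: (split h) => c //;
  apply: qle_trans.
Qed.

Definition qsum k l (P : qposet k) (Q : qposet l) : qposet (k + l) :=
  mk_qposet (@qsum_refl k l P Q) (@qsum_trans k l P Q).

Definition qp_mul (P Q : QP) : QP := qp (qsum (tagged P) (tagged Q)).

Definition qempty : qposet 0 :=
  mk_qposet (r := fun _ _ => true) (fun _ => isT) (fun _ _ _ _ _ => isT).

Definition qp_one : QP := qp qempty.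

Lemma qsumE k l (P : qposet k) (Q : qposet l) (i j : 'I_(k + l)) :
  qle (qsum P Q) i j = match split i, split j with
                       | inl a, inl b => qle P a b
                       | inr a, inr b => qle Q a b
                       | _, _ => false
                       end.
Proof. exact: qle_mk. Qed.

Fact qp_mulA : associative qp_mul.
Proof.
move=> [k P] [l Q] [m R]; apply: qp_eq => /=; first exact: addnA.
move=> i j i' j' ii' jj'; rewrite !qsumE.
have spl (x : 'I_(k + (l + m))) (x' : 'I_(k + l + m)) : x = x' :> nat ->
  match split x, split x' with
  | inl a, inl b => if split b is inl c then a = c else False
  | inr a, inl b => if split b is inr c then
                      if split a is inl d then d = c else False else False
  | inr a, inr b => if split a is inr d then d = b else False
  | _, _ => False end.
  move=> xx'; case: splitP => [a xa|a xa]; case: splitP => [b xb|b xb].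
  - case: splitP => [c bc|c bc]; first by apply/val_inj; rewrite /= -xa -bc -xb.
    by have := ltn_ord a; rewrite -xa xx' xb bc ltnNge leq_addr.
  - by have := ltn_ord a; rewrite -xa xx' xb -addnA ltnNge leq_addr.
  - case: splitP => [c bc|c bc].
      by have := ltn_ord c; rewrite -bc -xb -xx' xa ltnNge leq_addr.
    have ac : a = c :> nat.
      by apply/eqP; rewrite -(eqn_add2l k) -xa xx' xb bc.
    case: splitP => [d ad|d ad]; first by apply/val_inj; rewrite /= -ad.
    by have := ltn_ord c; rewrite -ac ad ltnNge leq_addr.
  - have ac : a = (l + b)%N :> nat.
      by apply/eqP; rewrite -(eqn_add2l k) -xa xx' xb addnA.
    case: splitP => [d ad|d ad].
      by have := ltn_ord d; rewrite -ad ac ltnNge leq_addr.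
    by apply/val_inj/eqP; rewrite /= -(eqn_add2l l) -ad ac.
have {ii'} := spl _ _ ii'; have {jj' spl} := spl _ _ jj'.
case: (split i) => ai; case: (split i') => bi;
 case: (split j) => aj; case: (split j') => bj; rewrite ?qsumE //;
 repeat match goal with |- context [split ?a] => case: (split a) => ? end;
 by do 2?[move=> //= ->].
Qed.

Fact qp_mul1m : left_id qp_one qp_mul.
Proof.
move=> [k P]; apply: qp_eq => //= i j i' j' ii' jj'; rewrite qsumE.
by case: splitP => [[]//|a ia]; case: splitP => [[]//|b jb];
  congr (qle P _ _); apply/val_inj; rewrite /= -?ii' -?jj' ?ia ?jb.
Qed.

Fact qp_mulm1 : right_id qp_one qp_mul.
Proof.
move=> [k P]; apply: qp_eq => /= [|i j i' j' ii' jj']; first exact: addn0.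
rewrite qsumE.
by case: splitP => [a ia|[]//]; case: splitP => [b jb|[]//];
  congr (qle P _ _); apply/val_inj; rewrite /= -?ii' -?jj' ?ia ?jb.
Qed.

Fact qp_unitm (P Q : QP) : qp_mul P Q = qp_one -> P = qp_one /\ Q = qp_one.
Proof.
case: P Q => [k P] [l Q] /(congr1 tag) /= /eqP; rewrite addn_eq0.
by case/andP => /eqP k0 /eqP l0; split; apply: qp_eq => // -[m mk];
  exfalso; move: mk; rewrite ?k0 ?l0.
Qed.

(* {malg K[QP]} thereby becomes the monoid algebra of (QP, disjoint union). *)
HB.instance Definition _ :=
  Choice_isMonomialDef.Build QP qp_mulA qp_mul1m qp_mulm1 qp_unitm.

End QuasiPosets.

Section PackedWords.

(* The letters of a packed word of length n are at most n, so that these words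
   are among the functions 'I_n -> {0, ..., n}; the letter 0 never occurs. *)
Definition is_packed n (w : {ffun 'I_n -> 'I_n.+1}) : bool :=
  [exists k : 'I_n.+1, [forall v : 'I_n.+1, (v \in codom w) == (0 < v <= k)%N]].

Record pword (n : nat) : Type :=
  PWord { pletter :> {ffun 'I_n -> 'I_n.+1}; pletterP : is_packed pletter }.

HB.instance Definition _ n := [isSub for @pletter n].
HB.instance Definition _ n := [Finite of pword n by <:].

Definition PW : Type := {n : nat & pword n}.
HB.instance Definition _ := Choice.on PW.

Definition pw n (w : pword n) : PW := Tagged pword w.

Definition Wset n (P : qposet n) : {set pword n} :=
  [set w : pword n | [forall i, forall j, qle P i j ==> (w i <= w j)%N]].

Definition Wstr n (P : qposet n) : {set pword n} :=
  [set w : pword n in Wset P |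
    [forall i, forall j, (qle P i j && (w i == w j)) ==> qsim P i j]].

End PackedWords.

Section LinearExtension.
Variables (K : fieldType) (B : choiceType) (V : lmodType K) (f : B -> V).

Definition lin_ext (x : {malg K[B]}) : V := \sum_(b <- msupp x) x@_b *: f b.

Lemma lin_extEw (D : {fset B}) (x : {malg K[B]}) : (msupp x `<=` D)%fset ->
  lin_ext x = \sum_(b <- D) x@_b *: f b.
Proof.
move=> sD; rewrite /lin_ext (big_fset_incl _ sD) // => b _ bx.
by rewrite mcoeff_outdom // scale0r.
Qed.

Lemma lin_ext_is_linear : linear lin_ext.
Proof.
move=> a x y; pose D := (msupp x `|` msupp y)%fset.
rewrite !(@lin_extEw D) ?fsubsetUl ?fsubsetUr //.
  rewrite scaler_sumr -big_split /=; apply: eq_bigr => b _.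
  by rewrite mcoeffD mcoeffZ scalerDl scalerA.
apply: fsubset_trans (msuppD_le _ _) _.
exact: fsetUSS (msuppZ_le _ _) (fsubset_refl _).
Qed.

HB.instance Definition _ :=
  GRing.isLinear.Build K {malg K[B]} V *:%R lin_ext lin_ext_is_linear.

Lemma lin_extU b : lin_ext << b >> = f b.
Proof.
by rewrite /lin_ext msuppU oner_eq0 big_seq_fset1 mcoeffUU scale1r.
Qed.

End LinearExtension.

(* The tensor product of {malg K[B]} and {malg K[C]} is {malg K[(B * C)%type]}, the
   basis element << (b, c) >> standing for b (x) c. *)
Section Tensor.
Variable K : fieldType.

Definition tens (B C : choiceType) (x : {malg K[B]}) (y : {malg K[C]}) :
  {malg K[(B * C)%type]} := lin_ext (fun b => lin_ext (fun c => << (b, c) >>) y) x.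

Definition tens_map (B C B' C' : choiceType)
    (f : {malg K[B]} -> {malg K[B']}) (g : {malg K[C]} -> {malg K[C']}) :
  {malg K[(B * C)%type]} -> {malg K[(B' * C')%type]} :=
  lin_ext (fun bc => tens (f << bc.1 >>) (g << bc.2 >>)).

End Tensor.

Section HopfAlgebra.
Variable K : fieldType.

Definition HQP : Type := {malg K[QP]}.
HB.instance Definition _ := GRing.Lalgebra.on HQP.

Definition HQP2 : Type := {malg K[(QP * QP)%type]}.
HB.instance Definition _ := GRing.Lmodule.on HQP2.

(* The product and unit are those of the monoid algebra {malg K[QP]}; [mprod]
   is the product seen as a linear map on the tensor square. *)
Definition mprod : HQP2 -> HQP :=
  lin_ext (fun PQ : QP * QP => (<< PQ.1 >> * << PQ.2 >> : HQP)).

Definition Delta : HQP -> HQP2 :=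
  lin_ext (fun P : QP => \sum_(O in top (tagged P))
    (<< (qp (qstd (tagged P) (~: O)), qp (qstd (tagged P) O)) >> : HQP2)).

(* The counit of Delta: the coefficient of the empty quasi-poset. *)
Definition counit (x : HQP) : K := x@_qp_one.

(* The antipode is the unique S satisfying this. *)
Definition is_antipode (S : HQP -> HQP) : Prop :=
  [/\ linear S,
      forall x, mprod (tens_map S id (Delta x)) = counit x *: 1
    & forall x, mprod (tens_map id S (Delta x)) = counit x *: 1].

Record hopf_automorphism (f : HQP -> HQP) : Prop := HopfAutomorphism {
  hopf_linear : linear f;
  hopf_bij : bijective f;
  hopf_unit : f 1 = 1;
  hopf_mul : {morph f : x y / x * y};
  hopf_counit : forall x, counit (f x) = counit x;
  hopf_comul : forall x, Delta (f x) = tens_map f f (Delta x);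
  hopf_antipode : forall S, is_antipode S -> forall x, f (S x) = S (f x)
}.

Definition Theta : HQP -> HQP :=
  lin_ext (fun P : QP =>
    \sum_(E : qposet (tag P) | is_equiv E && triangle E (tagged P))
      (<< qp (qquot (tagged P) E) >> : HQP)).

Definition Theta_inv : HQP -> HQP :=
  lin_ext (fun P : QP =>
    \sum_(E : qposet (tag P) | is_equiv E && triangle E (tagged P))
      (-1) ^+ (ncl (qsim (tagged P)) + ncl (qle E)) *:
        (<< qp (qquot (tagged P) E) >> : HQP)).

Definition WQSym : Type := {malg K[PW]}.
HB.instance Definition _ := GRing.Lmodule.on WQSym.

Definition EHR : HQP -> WQSym :=
  lin_ext (fun P : QP => \sum_(w in Wset (tagged P)) (<< pw w >> : WQSym)).

Definition EHRstr : HQP -> WQSym :=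
  lin_ext (fun P : QP => \sum_(w in Wstr (tagged P)) (<< pw w >> : WQSym)).

End HopfAlgebra.

Arguments Theta {K}.
Arguments Theta_inv {K}.
Arguments EHR {K}.
Arguments EHRstr {K}.

(* Main.v *)
Require Import Defs.
From HB Require Import structures.
From mathcomp Require Import all_boot all_algebra finmap.
From mathcomp.multinomials Require Import monalg.

(** Call an equivalence E with E <| P a contraction of P. The increasing real
    maps on P form a polyhedral cone, and the contractions of P are exactly
    its faces: E corresponds to the face of the maps that are constant on the
    classes of E, whose dimension is cl(E).

    Every point of the cone lies in the relative interior of exactly one face.
    Concretely, an increasing map w is strictly increasing on P/E for a single
    contraction E, whose classes are the connected components of the level
    sets of w (level_contraction, contraction_level). Summing over packed
    words gives the relation between Theta and the two Ehrhart maps.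

    If O is open in P, then the contractions E of P such that O stays open in
    P/E are the pairs made of a contraction of the complement of O and a
    contraction of O, and forming P/E commutes with restriction to either
    piece. This is sum_contraction_split, stated for any splitting of the
    ground set into a lower and an upper part; it yields the compatibility
    with the coproduct for the parts cut out by O, and the compatibility with
    the product for the two halves of a disjoint union.

    The contractions of P/E are the contractions of P that contain E
    (contraction_quot), and (P/E)/E' = P/E'. Hence both composites of Theta
    with the proposed inverse are governed by the sum of (-1)^cl(E) over the
    contractions E of P contained in a given contraction E'. These E are the
    contractions of the intersection of P with E' (contraction_meet), and so
    all that is needed is Euler's relation for cones (face_sumE): the sum of
    (-1)^cl(E) over all contractions E of P vanishes unless <=_P is symmetric,
    which is the case where the cone is a linear space and has one face. Its
    proof uses the compatibility with the coproduct. Write F(P) for the sum,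
    and consider the sum of F(P restricted to the complement of O) over the
    open sets O. Because each restriction of P to O has one and only one
    contraction with symmetric quotient (sum_components), the splitting lemma
    turns it into a sum, over the contractions E of P, of (-1)^cl(complement
    of O) over the open sets O of P/E on which P/E is symmetric. Adding a
    maximal class to O or removing it reverses the sign, so the sum is zero
    when P is nonempty. The expected value of F satisfies the same equations,
    by toggling a minimal class, and such equations have one solution
    (convolution_cancel), by induction on the size of P.

    The antipode is handled by the same uniqueness: a left convolution inverse
    S of the identity is determined by its defining equations, and
    Theta^-1 o S o Theta satisfies them because Theta is a bialgebra map. *)

Set Implicit Arguments.
Unset Strict Implicit.
Unset Printing Implicit Defensive.

Import GRing.Theory.
Local Open Scope ring_scope.

(** * Reachability in a finite relation *)

Lemma connect_ind (T : finType) (e : rel T) (x : T) (Q : T -> Prop) :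
  Q x -> (forall y z, connect e x y -> Q y -> e y z -> Q z) ->
  forall y, connect e x y -> Q y.
Proof.
move=> Qx step y /connectP[p]; elim/last_ind: p y => [|p z IH] y; first by move=> _ ->.
rewrite rcons_path last_rcons => /andP[pp pz] ->.
by apply: step pz; [apply/connectP; exists p | apply: IH].
Qed.

Lemma connect_map (T U : finType) (f : T -> U) (e : rel T) (e' : rel U) :
  (forall x y, e x y -> connect e' (f x) (f y)) ->
  forall x y, connect e x y -> connect e' (f x) (f y).
Proof.
move=> ee x; apply: connect_ind => // y z _ xy yz.
exact: connect_trans xy (ee _ _ yz).
Qed.

(** * Contractions in terms of relations *)

Lemma qposet_ext n (P Q : qposet n) : qle P =2 qle Q -> P = Q.
Proof. by move=> PQ; apply/val_inj/setP => -[i j]; apply: PQ. Qed.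

(** The classes of E are connected for P exactly when E is contained in the
    transitive closure of this relation. *)
Definition zigzag n (P E : qposet n) : rel 'I_n :=
  fun x y => qle E x y && (qle P x y || qle P y x).

Definition contraction n (P E : qposet n) : bool := is_equiv E && triangle E P.

Lemma qle_quot n (P E : qposet n) :
  qle (qquot P E) =2 connect (fun x y => qle P x y || qle E x y).
Proof. exact: qle_mk. Qed.

Lemma qle_std n (P : qposet n) (A : {set 'I_n}) i j :
  qle (qstd P A) i j = qle P (enum_val i) (enum_val j).
Proof. exact: qle_mk. Qed.

Lemma qequivP n (E : qposet n) : reflect (symmetric (qle E)) (is_equiv E).
Proof.
apply: (iffP forallP) => [sE i j|sE i]; last first.
  by apply/forallP => j; rewrite sE implybb.
by apply/idP/idP; move: (sE i) (sE j) => /forallP/(_ j)/implyP + /forallP/(_ i)/implyP; auto.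
Qed.

Lemma topP n (P : qposet n) (O : {set 'I_n}) :
  reflect (forall i j, i \in O -> qle P i j -> j \in O) (O \in top P).
Proof.
rewrite inE; apply: (iffP forallP) => [oO i j iO ij|oO i].
  by move: (oO i) => /forallP/(_ j)/implyP/(_ iO)/implyP/(_ ij).
by apply/forallP => j; apply/implyP => iO; apply/implyP; apply: oO.
Qed.

(** A union of connected components is open, and so is its complement; so
    topological connectedness is zigzag connectedness inside C. *)
Lemma qconnectedP n (P : qposet n) (C : {set 'I_n}) :
  reflect {in C &, forall i j, connect
     (fun x y => [&& x \in C, y \in C & qle P x y || qle P y x]) i j}
    (qconnected (qstd P C)).
Proof.
pose e : rel 'I_n := fun x y => [&& x \in C, y \in C & qle P x y || qle P y x].
have es : connect_sym e.
  by apply: sym_connect_sym => x y; rewrite /e andbCA orbC.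
apply: (iffP idP) => [cC i j iC jC|cC]; last first.
  apply/existsP => -[O1 /andP[/topP o1 /existsP[O2 /andP[/topP o2]]]].
  case/and4P => /set0Pn[a aO1] /set0Pn[b bO2] /pred0P dis /eqP/setP cov.
  have disF x : x \in O1 -> x \in O2 -> False.
    by move=> x1 x2; have := dis x; rewrite /= x1 x2.
  pose Q (z : 'I_n) := exists2 c, z = enum_val c & c \in O1.
  suff [c /enum_val_inj <- ] : Q (enum_val b) by move=> /disF; apply.
  apply: (connect_ind (Q := Q) _ _ (cC _ _ (enum_valP a) (enum_valP b))).
    by exists a.
  move=> _ z _ [c -> cO] /and3P[_ zC cz].
  exists (enum_rank_in zC z); first by rewrite enum_rankK_in.
  case/orP: cz => cz.
    by apply: (o1 _ _ cO); rewrite qle_std enum_rankK_in.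
  have := cov (enum_rank_in zC z); rewrite !inE => /orP[//|zO].
  case: (disF _ cO); apply: (o2 _ _ zO); by rewrite qle_std enum_rankK_in.
apply: contraNT cC => nij.
(* If j is not reached from i, the component of i and its complement separate C. *)
pose O1 := [set a : 'I_#|C| | connect e i (enum_val a)].
have stp (a b : 'I_#|C|) : qle (qstd P C) a b ->
    connect e i (enum_val a) = connect e i (enum_val b).
  rewrite qle_std => ab; apply: same_connect_r => //; apply: connect1.
  by rewrite /e !enum_valP ab.
apply/existsP; exists O1; apply/andP; split.
  by apply/topP => a b; rewrite !inE => ia /stp <-.
apply/existsP; exists (~: O1); apply/andP; split.
  by apply/topP => a b; rewrite !inE => ia /stp <-.
apply/and4P; split; last by rewrite setUCr.
- by apply/set0Pn; exists (enum_rank_in iC i); rewrite inE enum_rankK_in.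
- by apply/set0Pn; exists (enum_rank_in jC j); rewrite !inE enum_rankK_in.
- by rewrite -setI_eq0 setICr.
Qed.

(** Every later argument about E <| P goes through these three conditions on
    relations; together with symmetry, they say that the classes of E are
    connected and that P/E creates no further equivalence. *)
Lemma contractionP n (P E : qposet n) :
  reflect [/\ symmetric (qle E), subrel (qle E) (connect (zigzag P E))
            & forall i j, qle (qquot P E) i j -> qle (qquot P E) j i -> qle E i j]
          (contraction P E).
Proof.
have EQ x y : qle E x y -> qle (qquot P E) x y.
  by move=> xy; rewrite qle_quot; apply: connect1; rewrite xy orbT.
apply: (iffP andP) => [[/qequivP sE /andP[/forallP cE /forallP qE]]|[sE cE qE]].
  split=> // [i j ij|i j ij ji]; last first.
    by move: (qE i) => /forallP/(_ j)/eqP <-; rewrite /qsim ij ji.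
  pose C := [set y | qle E i y].
  have CP : C \in equivalence_partition (qle E) [set: 'I_n].
    by apply/imsetP; exists i => //; apply/setP => y; rewrite !inE.
  have /implyP/(_ CP)/qconnectedP cC := cE C.
  have := cC i j; rewrite !inE qle_refl ij => /(_ isT isT).
  apply: connect_sub => x y /and3P[]; rewrite !inE => ix iy xy.
  by apply: connect1; rewrite /zigzag xy andbT (qle_trans _ iy) // sE.
split; first exact/qequivP.
apply/andP; split.
  apply/forallP => C; apply/implyP => /imsetP[i _ ->].
  apply/qconnectedP => x y; rewrite !inE /= => ix iy.
  have xy : qle E x y by apply: qle_trans iy; rewrite sE.
  suff [] : qle E i y /\ connect
     (fun x y => [&& x \in [set y in setT | qle E i y],
                     y \in [set y in setT | qle E i y] & qle P x y || qle P y x]) x y by [].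
  apply: (connect_ind (Q := fun y => _ /\ _) _ _ (cE _ _ xy)) => //.
  move=> {xy}{}y z _ [{}iy xy] /andP[yz Pyz]; have iz := qle_trans iy yz.
  by split=> //; apply: connect_trans xy (connect1 _); rewrite !inE iy iz.
apply/forallP => i; apply/forallP => j; apply/eqP.
apply/idP/idP => [/andP[]|ij]; first exact: qE.
by apply/andP; split; apply: EQ; rewrite // sE.
Qed.
Arguments contractionP {n P E}.

(** * Quotients and iterated contractions *)

Lemma quot_lel n (P E : qposet n) : subrel (qle P) (qle (qquot P E)).
Proof. by move=> i j ij; rewrite qle_quot; apply: connect1; rewrite ij. Qed.

Lemma quot_ler n (P E : qposet n) : subrel (qle E) (qle (qquot P E)).
Proof. by move=> i j ij; rewrite qle_quot; apply: connect1; rewrite ij orbT. Qed.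

Lemma quot_sub n (P E R : qposet n) :
  subrel (qle P) (qle R) -> subrel (qle E) (qle R) ->
  subrel (qle (qquot P E)) (qle R).
Proof.
move=> PR ER i j; rewrite qle_quot; move: j.
apply: connect_ind => [|y z _ iy /orP[/PR|/ER]]; first exact: qle_refl.
  exact: qle_trans.
exact: qle_trans.
Qed.

Lemma quot_mono n (P P' E E' : qposet n) :
  subrel (qle P) (qle P') -> subrel (qle E) (qle E') ->
  subrel (qle (qquot P E)) (qle (qquot P' E')).
Proof.
move=> PP EE; apply: quot_sub => i j ij; first exact/quot_lel/PP.
exact/quot_ler/EE.
Qed.

Lemma quot_monor n (P E E' : qposet n) : subrel (qle E) (qle E') ->
  subrel (qle (qquot P E)) (qle (qquot P E')).
Proof. exact: quot_mono. Qed.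

Lemma quot_monol n (P P' E : qposet n) : subrel (qle P) (qle P') ->
  subrel (qle (qquot P E)) (qle (qquot P' E)).
Proof. by move=> PP; apply: quot_mono. Qed.

Lemma quot_quot n (P E E' : qposet n) :
  subrel (qle E) (qle E') -> qquot (qquot P E) E' = qquot P E'.
Proof.
move=> EE; apply: qposet_ext => i j; apply/idP/idP.
  apply: quot_sub; last exact: quot_ler.
  exact: quot_mono.
apply: quot_mono => //; exact: quot_lel.
Qed.

Lemma qsim_quot n (P E : qposet n) : contraction P E -> qsim (qquot P E) =2 qle E.
Proof.
move=> /contractionP[sE _ aE] i j; apply/andP/idP => [[]|ij]; first exact: aE.
by split; apply: quot_ler; rewrite // sE.
Qed.

(** The disjoint union of the restrictions of P to the classes of E, kept on
    the same ground set. *)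
Definition qmeet n (P E : qposet n) : qposet n :=
  mk_qposet (r := fun x y => qle P x y && qle E x y)
    (fun x => introT andP (conj (qle_refl P x) (qle_refl E x)))
    (fun y x z (xy : _ && _) (yz : _ && _) =>
       match elimT andP xy, elimT andP yz with
       | conj p e, conj p' e' => introT andP (conj (qle_trans p p') (qle_trans e e'))
       end).

Lemma qle_meet n (P E : qposet n) i j :
  qle (qmeet P E) i j = qle P i j && qle E i j.
Proof. exact: qle_mk. Qed.

Definition qsub n (E E' : qposet n) : bool := qgraph E \subset qgraph E'.

Lemma qsubP n (E E' : qposet n) : reflect (subrel (qle E) (qle E')) (qsub E E').
Proof. by apply: (iffP subsetP) => [EE i j|EE [i j]]; apply: EE. Qed.

(** The chain that witnesses the inequality i <= j of P/E runs between two
    elements that are equivalent in P/E'. So do all its intermediate points,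
    and each of its steps is therefore inside one class of E'. *)
Lemma quot_meet n (P E E' : qposet n) i j :
  contraction P E' -> subrel (qle E) (qle E') ->
  qle (qquot P E) i j -> qle (qquot P E') j i -> qle (qquot (qmeet P E') E) i j.
Proof.
move=> /contractionP[sE' _ aE'] EE; rewrite qle_quot.
have PE := quot_monor (P := P) EE.
move: j; apply: connect_ind => [_|y z iy IH yz zi]; first exact: qle_refl.
rewrite -qle_quot in iy.
have {}yz : qle (qmeet P E') y z || qle E y z.
  case/orP: yz => [Pyz|->]; last by rewrite orbT.
  have yi : qle (qquot P E') y i by apply: qle_trans zi; apply: quot_lel.
  have E'y : qle E' y i by apply: aE' => //; apply: PE.
  have iz := qle_trans (PE _ _ iy) (quot_lel E' Pyz).
  by rewrite qle_meet Pyz (qle_trans E'y (aE' _ _ iz zi)).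
have yz' : qle (qquot (qmeet P E') E) y z.
  by case/orP: yz; [apply: quot_lel | apply: quot_ler].
apply: (qle_trans (IH _) (yz')); apply: qle_trans zi.
apply: (PE y z); apply: (quot_monol _ yz') => u v.
by rewrite qle_meet => /andP[].
Qed.

Lemma zigzag_mono n (P P' E E' : qposet n) :
  subrel (qle P) (qle P') -> subrel (qle E) (qle E') ->
  subrel (connect (zigzag P E)) (connect (zigzag P' E')).
Proof.
move=> PP EE; apply: connect_sub => x y /andP[/EE xy Pxy]; apply: connect1.
by rewrite /zigzag xy; case/orP: Pxy => /PP ->; rewrite ?orbT.
Qed.

(** Faces of a face of the cone are the faces of the cone contained in it; the
    face of E' is contained in the face of E when E is contained in E'. *)
Lemma contraction_quot n (P E E' : qposet n) : contraction P E ->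
  contraction (qquot P E) E' = contraction P E' && qsub E E'.
Proof.
move=> cE; have [sE kE aE] := contractionP cE.
apply/idP/andP => [cE'|[cE' /qsubP EE]]; last first.
  have [sE' kE' aE'] := contractionP cE'.
  apply/contractionP; split=> //; last by rewrite quot_quot.
  move=> i j /kE'; apply: zigzag_mono => //; exact: quot_lel.
have [sE' kE' aE'] := contractionP cE'.
have EE : subrel (qle E) (qle E').
  move=> i j ij; apply: aE'; apply/quot_lel/quot_ler => //; by rewrite sE.
split; last exact/qsubP.
rewrite quot_quot // in aE'.
apply/contractionP; split=> // i j /kE'.
have key x y : qle (qquot P E) x y -> qle E' x y -> connect (zigzag P E') x y.
  rewrite qle_quot => xy E'xy.
  suff H : qle (qquot P E') y x -> connect (zigzag P E') x y.
    by apply/H/quot_ler; rewrite sE'.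
  move: y xy {E'xy}; apply: connect_ind => // y z; rewrite -qle_quot => xy IH yz zx.
  have PE := quot_monor (P := P) EE.
  have {}yz' : qle (qquot P E') y z.
    by case/orP: yz => [/quot_lel|/EE /quot_ler]; apply.
  have yx := qle_trans yz' zx; apply: connect_trans (IH yx) _.
  case/orP: yz => [Pyz|/kE]; last exact: zigzag_mono.
  apply: connect1; rewrite /zigzag Pyz andbT; apply: (@qle_trans _ _ x).
    by apply: aE' => //; apply: PE.
  by apply: aE' => //; apply: qle_trans yz'; apply: PE.
apply: connect_sub => x y /andP[xy /orP[]]; first by move/key; apply.
move/key; rewrite sE' => /(_ xy).
have zS : connect_sym (zigzag P E').
  by apply: sym_connect_sym => u v; rewrite /zigzag sE' orbC.
by rewrite zS.
Qed.

(** The contractions of P below E' are those of P cut along E'. This turns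
    sums over an interval of contractions into sums over all contractions of
    another quasi-poset. *)
Lemma contraction_meet n (P E E' : qposet n) : contraction P E' ->
  contraction (qmeet P E') E = contraction P E && qsub E E'.
Proof.
move=> cE'; have [sE' kE' aE'] := contractionP cE'.
have ml : subrel (qle (qmeet P E')) (qle P).
  by move=> i j; rewrite qle_meet => /andP[].
apply/idP/andP => [cE|[cE /qsubP EE]]; have [sE kE aE] := contractionP cE.
  have EE : subrel (qle E) (qle E').
    move=> i j /kE; move: j; apply: connect_ind => [|y z _ iy]; first exact: qle_refl.
    rewrite /zigzag !qle_meet (sE' z) => /andP[_].
    by rewrite -andb_orl => /andP[_]; apply: qle_trans.
  have PE := quot_monor (P := P) EE.
  split; last exact/qsubP.
  apply/contractionP; split=> // i j; last first.
    by move=> ij ji; apply: aE; apply: quot_meet => //; apply: PE.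
  by move/kE; apply: zigzag_mono.
apply/contractionP; split=> // i j.
  move/kE; apply: connect_sub => x y /andP[xy Pxy]; apply: connect1.
  by rewrite /zigzag xy !qle_meet -(sE' x) (EE _ _ xy) !andbT.
by move=> ij ji; apply: aE; apply: (quot_monol ml).
Qed.

(** * Level components of increasing maps *)

Definition weakly_increasing n (P : qposet n) (w : 'I_n -> nat) : Prop :=
  forall i j, qle P i j -> (w i <= w j)%N.

Definition strictly_increasing n (P : qposet n) (w : 'I_n -> nat) : Prop :=
  weakly_increasing P w /\ forall i j, qle P i j -> w i = w j -> qle P j i.

(** The equivalence whose classes are the connected components, for P, of the
    level sets of w. *)
Definition level_quot n (P : qposet n) (w : 'I_n -> nat) : qposet n :=
  let r : rel 'I_n := fun x y => (w x == w y) && (qle P x y || qle P y x) in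
  mk_qposet (r := connect r) (@connect0 _ r) (@connect_trans _ r).

Lemma qle_level n (P : qposet n) w : qle (level_quot P w) =2
  connect (fun x y => (w x == w y) && (qle P x y || qle P y x)).
Proof. exact: qle_mk. Qed.

Lemma level_const n (P : qposet n) w x y : qle (level_quot P w) x y -> w x = w y.
Proof.
by rewrite qle_level; move: y; apply: connect_ind => // y z _ -> /andP[/eqP].
Qed.

Lemma level_increasing n (P : qposet n) w : weakly_increasing P w ->
  weakly_increasing (qquot P (level_quot P w)) w.
Proof.
move=> wP i j; rewrite qle_quot; move: j; apply: connect_ind => // y z _ iy.
by case/orP => [/wP/(leq_trans iy)//|/level_const <-].
Qed.

(** A chain of P/(level_quot P w) along which w does not increase stays in a
    level set of w, and then each of its steps stays in a component. *)
Lemma level_strict n (P : qposet n) w : weakly_increasing P w ->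
  forall i j, qle (qquot P (level_quot P w)) i j -> w i = w j ->
    qle (level_quot P w) i j.
Proof.
move=> wP i j; rewrite qle_quot; move: j; apply: connect_ind => [_|y z iy IH yz iz].
  exact: qle_refl.
have wyz : (w y <= w z)%N.
  by case/orP: yz => [/wP|/level_const ->].
have wiy : (w i <= w y)%N by apply: (level_increasing wP); rewrite qle_quot.
have eiy : w i = w y by apply/eqP; rewrite eqn_leq wiy iz wyz.
apply: qle_trans (IH eiy) _; case/orP: yz => // yz.
by rewrite qle_level; apply: connect1; rewrite -eiy iz eqxx yz.
Qed.

Lemma level_contraction n (P : qposet n) w : weakly_increasing P w ->
  contraction P (level_quot P w) /\
  strictly_increasing (qquot P (level_quot P w)) w.
Proof.
move=> wP; have sL : symmetric (qle (level_quot P w)).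
  move=> i j; rewrite !qle_level; move: i j; apply: sym_connect_sym => x y.
  by rewrite eq_sym orbC.
have wQ := level_increasing wP.
split; last first.
  split=> // i j ij wij; apply: quot_ler; rewrite sL; exact: level_strict.
apply/contractionP; split=> // i j; last first.
  move=> ij ji; apply: level_strict => //.
  by apply/eqP; rewrite eqn_leq !wQ.
rewrite qle_level; apply: connect_sub => x y /andP[wxy Pxy].
apply: connect1; rewrite /zigzag Pxy andbT qle_level.
by apply: connect1; rewrite wxy.
Qed.

(** Strictness forces E to absorb every comparison of P inside a level set of
    w, while the classes of E are connected and w is constant on them; so E is
    made of the components of the level sets. *)
Lemma contraction_level n (P E : qposet n) w : contraction P E ->
  strictly_increasing (qquot P E) w -> weakly_increasing P w /\ E = level_quot P w.
Proof.
move=> /contractionP[sE kE aE] [wQ sQ].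
have wP : weakly_increasing P w by move=> i j ij; exact: wQ (quot_lel E ij).
split=> //; apply: qposet_ext => i j; rewrite qle_level.
apply/idP/idP => [/kE|].
  apply: connect_sub => x y /andP[xy Pxy]; apply: connect1; rewrite Pxy andbT.
  by rewrite eqn_leq; apply/andP; split; apply: wQ; apply: quot_ler; rewrite // sE.
move: j; apply: connect_ind => [|y z _ iy /andP[/eqP wyz Pyz]]; first exact: qle_refl.
apply: qle_trans iy _; case/orP: Pyz => Pyz.
  by have Q := quot_lel E Pyz; apply: aE => //; apply: sQ.
by have Q := quot_lel E Pyz; apply: aE => //; apply: sQ.
Qed.

(** * Restriction along convex maps *)

Lemma quot_step n (P E : qposet n) x y :
  qle P x y || qle E x y -> qle (qquot P E) x y.
Proof. by case/orP; [apply: quot_lel | apply: quot_ler]. Qed.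

Definition qpull m n (f : 'I_m -> 'I_n) (P : qposet n) : qposet m :=
  mk_qposet (r := fun i j => qle P (f i) (f j))
    (fun i => qle_refl P (f i)) (fun j i k => @qle_trans n P (f j) (f i) (f k)).

Lemma qle_pull m n (f : 'I_m -> 'I_n) P i j : qle (qpull f P) i j = qle P (f i) (f j).
Proof. exact: qle_mk. Qed.

Definition convex_map m n (f : 'I_m -> 'I_n) (Q : qposet n) : Prop :=
  forall a b z, qle Q (f a) z -> qle Q z (f b) -> exists c, z = f c.

Section Pullback.
Variables (m n : nat) (f : 'I_m -> 'I_n) (P E : qposet n).
Hypotheses (f_inj : injective f) (f_cvx : convex_map f (qquot P E)).

(** A chain of P/E joining two points of a convex set remains in that set, so
    it can be read off from the restrictions of P and E. *)
Lemma pull_quot : qpull f (qquot P E) = qquot (qpull f P) (qpull f E).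
Proof.
apply: qposet_ext => a b; rewrite qle_pull; apply/idP/idP.
  rewrite qle_quot => ab; pose Q z := qle (qquot P E) z (f b) ->
    exists2 c, z = f c & qle (qquot (qpull f P) (qpull f E)) a c.
  suff /(_ (qle_refl _ _)) [c /f_inj -> //] : Q (f b).
  apply: (connect_ind _ _ ab) => [_|y z ay Qy].
    by exists a; rewrite ?qle_refl.
  move=> yz zb; have zy := quot_step yz.
  have [c yE ac] := Qy (qle_trans zy zb).
  rewrite -qle_quot in ay.
  have [d zE] := f_cvx (qle_trans ay zy) zb; exists d => //.
  apply: (qle_trans ac); apply: quot_step.
  by rewrite !qle_pull -yE -zE.
rewrite !qle_quot; apply: connect_map => x y; rewrite !qle_pull => xy.
exact: connect1.
Qed.

(** The classes of E that meet a convex set of P/E are contained in it, since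
    their elements are equivalent in P/E. *)
Lemma contraction_pull : contraction P E -> contraction (qpull f P) (qpull f E).
Proof.
case/contractionP => sE kE aE; apply/contractionP; split.
- by move=> a b; rewrite !qle_pull sE.
- move=> a b; rewrite qle_pull => /kE ab.
  pose Q z := exists2 c, z = f c & connect (zigzag (qpull f P) (qpull f E)) a c.
  suff [c /f_inj -> //] : Q (f b).
  apply: (connect_ind _ _ ab); first by exists a.
  move=> _ z _ [c -> ac] /andP[cz Pcz].
  have [d zE] : exists d, z = f d.
    by apply: (f_cvx (a := c) (b := c)); apply: quot_ler; rewrite // sE.
  exists d => //; apply: connect_trans ac (connect1 _).
  by rewrite /zigzag !qle_pull -zE cz.
- by move=> a b; rewrite -pull_quot !qle_pull; apply: aE.
Qed.

End Pullback.

(** * Splitting a quasi-poset into a lower and an upper part *)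

Section Splitting.
Variables (k l n : nat) (h : 'I_k + 'I_l -> 'I_n) (hinv : 'I_n -> 'I_k + 'I_l).
Hypotheses (hK : cancel h hinv) (hinvK : cancel hinv h).

Definition lower_part (a : 'I_k) : 'I_n := h (inl a).
Definition upper_part (b : 'I_l) : 'I_n := h (inr b).
Local Notation f1 := lower_part.
Local Notation f2 := upper_part.

Lemma lower_inj : injective f1.
Proof. by move=> a b /(can_inj hK)[]. Qed.

Lemma upper_inj : injective f2.
Proof. by move=> a b /(can_inj hK)[]. Qed.

Lemma splitting_cases z : (exists a, z = f1 a) \/ (exists b, z = f2 b).
Proof.
by rewrite -[z]hinvK; case: (hinv z) => c; [left | right]; exists c.
Qed.

(** Said of P, this means that the upper part is open; said of an equivalence,
    that no class meets both parts. *)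
Definition no_descent (P : qposet n) : bool :=
  [forall b, forall a, ~~ qle P (f2 b) (f1 a)].

Lemma no_descentP P : reflect (forall b a, qle P (f2 b) (f1 a) = false) (no_descent P).
Proof.
apply: (iffP forallP) => [nP b a|nP b].
  by apply/negbTE; move: (nP b) => /forallP.
by apply/forallP => a; rewrite nP.
Qed.

Lemma no_descent_quot P E : no_descent P -> no_descent E -> no_descent (qquot P E).
Proof.
move=> /no_descentP nP /no_descentP nE; apply/no_descentP => b a; rewrite qle_quot.
apply/negP => ba; pose Q z := exists c, z = f2 c.
suff [c /(can_inj hK)] : Q (f1 a) by [].
apply: (connect_ind _ _ ba); first by exists b.
move=> _ z _ [c ->]; case: (splitting_cases z) => -[d ->]; last by exists d.
by rewrite nP nE.
Qed.

Lemma lower_convex Q : no_descent Q -> convex_map f1 Q.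
Proof.
move=> /no_descentP nQ a b z az zb; case: (splitting_cases z) => -[c zE].
  by exists c.
by rewrite zE nQ in zb.
Qed.

Lemma upper_convex Q : no_descent Q -> convex_map f2 Q.
Proof.
move=> /no_descentP nQ a b z az zb; case: (splitting_cases z) => -[c zE].
  by rewrite zE nQ in az.
by exists c.
Qed.

(** In P/E too the upper part is open, so both parts are convex and no zigzag
    or cycle uses points from both. *)
Lemma contraction_split P E : no_descent P -> no_descent E -> symmetric (qle E) ->
  contraction P E = contraction (qpull f1 P) (qpull f1 E) &&
                    contraction (qpull f2 P) (qpull f2 E).
Proof.
move=> nP nE sE; have nQ := no_descent_quot nP nE.
have v1 := lower_convex nQ; have v2 := upper_convex nQ.
have nE1 b a : qle E (f2 b) (f1 a) = false by apply: no_descentP.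
have nE2 b a : qle E (f1 a) (f2 b) = false by rewrite sE.
have nQ1 b a : qle (qquot P E) (f2 b) (f1 a) = false by apply: no_descentP.
apply/idP/andP => [cE|[/contractionP[_ k1 a1] /contractionP[_ k2 a2]]].
  by split; apply: contraction_pull => //; [apply: lower_inj | apply: upper_inj].
have zz m (f : 'I_m -> 'I_n) a b :
    connect (zigzag (qpull f P) (qpull f E)) a b -> connect (zigzag P E) (f a) (f b).
  apply: connect_map => x y; rewrite /zigzag !qle_pull => xy; exact: connect1.
apply/contractionP; split=> // i j; case: (splitting_cases i) => -[a ->];
  case: (splitting_cases j) => -[b ->]; rewrite ?nE1 ?nE2 ?nQ1 //.
- by move=> ab; apply/zz/k1; rewrite qle_pull.
- by move=> ab; apply/zz/k2; rewrite qle_pull.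
- move=> ab ba; rewrite -qle_pull; apply: a1; rewrite -pull_quot ?qle_pull //; exact: lower_inj.
- move=> ab ba; rewrite -qle_pull; apply: a2; rewrite -pull_quot ?qle_pull //; exact: upper_inj.
Qed.

Definition glue_rel (E1 : qposet k) (E2 : qposet l) : rel 'I_n := fun i j =>
  match hinv i, hinv j with
  | inl a, inl b => qle E1 a b
  | inr a, inr b => qle E2 a b
  | _, _ => false
  end.

Lemma glue_refl E1 E2 : reflexive (glue_rel E1 E2).
Proof. by move=> i; rewrite /glue_rel; case: hinv => a; apply: qle_refl. Qed.

Lemma glue_trans E1 E2 : transitive (glue_rel E1 E2).
Proof.
move=> j i c; rewrite /glue_rel; case: (hinv i) => x; case: (hinv j) => y;
  case: (hinv c) => z //; exact: qle_trans.
Qed.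

Definition glue E1 E2 : qposet n := mk_qposet (glue_refl E1 E2) (@glue_trans E1 E2).

Lemma qle_glue E1 E2 i j : qle (glue E1 E2) i j = glue_rel E1 E2 i j.
Proof. exact: qle_mk. Qed.

Lemma pull_glue_lower E1 E2 : qpull f1 (glue E1 E2) = E1.
Proof. by apply: qposet_ext => a b; rewrite qle_pull qle_glue /glue_rel !hK. Qed.

Lemma pull_glue_upper E1 E2 : qpull f2 (glue E1 E2) = E2.
Proof. by apply: qposet_ext => a b; rewrite qle_pull qle_glue /glue_rel !hK. Qed.

Lemma glue_pull E : no_descent E -> (forall a b, qle E (f1 a) (f2 b) = false) ->
  glue (qpull f1 E) (qpull f2 E) = E.
Proof.
move=> /no_descentP nE nE'; apply: qposet_ext => i j; rewrite qle_glue /glue_rel.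
rewrite -[in RHS](hinvK i) -[in RHS](hinvK j).
case: (hinv i) => a; case: (hinv j) => b; rewrite ?qle_pull //; first by rewrite nE'.
by rewrite nE.
Qed.

(** Restricting to the two parts is a bijection, inverse to gluing, from the
    contractions of P that respect the splitting to pairs of contractions.
    Both compatibilities of Theta, and Euler's relation below, rest on it. *)
Lemma sum_contraction_split (V : zmodType) (P : qposet n)
    (G : qposet k -> qposet l -> V) : no_descent P ->
  \sum_(E | contraction P E && no_descent E) G (qpull f1 E) (qpull f2 E) =
  \sum_(E1 | contraction (qpull f1 P) E1)
    \sum_(E2 | contraction (qpull f2 P) E2) G E1 E2.
Proof.
move=> nP; rewrite pair_big /=.
rewrite (reindex_onto (fun p => glue p.1 p.2)
  (fun E => (qpull f1 E, qpull f2 E))) /=.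
  apply: eq_big => -[E1 E2] /=; rewrite pull_glue_lower pull_glue_upper ?eqxx //.
  rewrite andbT; have nG : no_descent (glue E1 E2).
    by apply/no_descentP => b a; rewrite qle_glue /glue_rel !hK.
  rewrite nG andbT.
  apply/idP/idP => [cG|/andP[c1 c2]].
    have [sG _ _] := contractionP cG.
    by move: cG; rewrite contraction_split // pull_glue_lower pull_glue_upper.
  have [s1 _ _] := contractionP c1; have [s2 _ _] := contractionP c2.
  rewrite contraction_split // ?pull_glue_lower ?pull_glue_upper ?c1 //.
  move=> i j; rewrite !qle_glue /glue_rel; case: (hinv i) => a; case: (hinv j) => b //.
move=> E /andP[/contractionP[sE _ _] nE]; apply: glue_pull => // a b.
by rewrite sE; apply: no_descentP.
Qed.

End Splitting.

(** * Linear maps out of a free module *)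

Section LinearMaps.
Variable K : fieldType.

Lemma lin_ext_linear (B : choiceType) (V : lmodType K) (f : B -> V) :
  linear (lin_ext f).
Proof. exact: lin_ext_is_linear. Qed.

Lemma lin_ext_comb (B : choiceType) (V : lmodType K) (f f1 f2 : B -> V) a x :
  (forall b, f b = a *: f1 b + f2 b) ->
  lin_ext f x = a *: lin_ext f1 x + lin_ext f2 x.
Proof.
move=> fE; rewrite /lin_ext scaler_sumr -big_split; apply: eq_bigr => b _.
by rewrite /= fE scalerDr !scalerA [_ * a]mulrC.
Qed.

Lemma lin_extP (B : choiceType) (V : lmodType K) (f : {malg K[B]} -> V) :
  linear f -> f =1 lin_ext (fun b => f << b >>).
Proof.
move=> fL x; pose m := GRing.isLinear.Build K _ _ _ f fL.
pose F : {linear {malg K[B]} -> V} := HB.pack f m.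
rewrite -[f]/(F : _ -> _) /lin_ext [in LHS](monalgE x) linear_sum.
apply: eq_bigr => b _; rewrite -linearZ; congr (F _); apply/malgP => c.
by rewrite mcoeffZ !mcoeffU mulr_natr.
Qed.

Lemma linear_eq (B : choiceType) (V : lmodType K) (f g : {malg K[B]} -> V) :
  linear f -> linear g -> (forall b, f << b >> = g << b >>) -> f =1 g.
Proof.
move=> fL gL fg x; rewrite lin_extP // [RHS]lin_extP //.
by apply: eq_bigr => b _; rewrite fg.
Qed.

Lemma linear_comp (U V W : lmodType K) (f : V -> W) (g : U -> V) :
  linear f -> linear g -> linear (f \o g).
Proof. by move=> fL gL a x y; rewrite /= gL fL. Qed.

Lemma linear_bigsum (U V : lmodType K) (f : U -> V) (I : finType) (P : pred I) (F : I -> U) :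
  linear f -> f (\sum_(i | P i) F i) = \sum_(i | P i) f (F i).
Proof.
move=> fL; pose m := GRing.isLinear.Build K _ _ _ f fL.
pose F' : {linear U -> V} := HB.pack f m.
exact: (linear_sum F').
Qed.

Lemma linear_scale (U V : lmodType K) (f : U -> V) a x :
  linear f -> f (a *: x) = a *: f x.
Proof.
move=> fL; pose m := GRing.isLinear.Build K _ _ _ f fL.
by pose F : {linear U -> V} := HB.pack f m; exact: (linearZ_LR F).
Qed.

Lemma tensUU (B C : choiceType) (b : B) (c : C) :
  tens (<< b >> : {malg K[B]}) (<< c >> : {malg K[C]}) = << (b, c) >>.
Proof. by rewrite /tens !lin_extU. Qed.

Lemma tens_linearl (B C : choiceType) (y : {malg K[C]}) :
  linear (fun x : {malg K[B]} => tens x y).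
Proof. exact: lin_ext_linear. Qed.

Lemma tens_linearr (B C : choiceType) (x : {malg K[B]}) :
  linear (fun y : {malg K[C]} => tens x y).
Proof.
move=> a y z; apply: lin_ext_comb => b; exact: lin_ext_linear.
Qed.

Lemma tens_sum (B C : choiceType) (I J : finType) (P : pred I) (Q : pred J)
    (b : I -> {malg K[B]}) (c : J -> {malg K[C]}) :
  tens (\sum_(i | P i) b i) (\sum_(j | Q j) c j) =
  \sum_(i | P i) \sum_(j | Q j) tens (b i) (c j).
Proof.
rewrite (linear_bigsum _ _ (tens_linearl _)); apply: eq_bigr => i _.
exact: (linear_bigsum _ _ (tens_linearr _)).
Qed.

Lemma tens_map_linear (B C B' C' : choiceType)
  (f : {malg K[B]} -> {malg K[B']}) (g : {malg K[C]} -> {malg K[C']}) :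
  linear (tens_map f g).
Proof. exact: lin_ext_linear. Qed.

Lemma tens_mapU (B C B' C' : choiceType)
  (f : {malg K[B]} -> {malg K[B']}) (g : {malg K[C]} -> {malg K[C']}) b c :
  tens_map f g << (b, c) >> = tens (f << b >>) (g << c >>).
Proof. by rewrite /tens_map lin_extU. Qed.

End LinearMaps.

(** * Compatibility with the product *)

Section ThetaMultiplicative.
Variable K : fieldType.

Lemma ThetaE n (P : qposet n) : Theta (<< qp P >> : HQP K) =
  \sum_(E | contraction P E) << qp (qquot P E) >>.
Proof. by rewrite /Theta lin_extU. Qed.

Lemma DeltaE n (P : qposet n) : Delta (<< qp P >> : HQP K) =
  \sum_(O in top P) << (qp (qstd P (~: O)), qp (qstd P O)) >>.
Proof. by rewrite /Delta lin_extU. Qed.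

Lemma Theta_linear : linear (@Theta K).
Proof. exact: lin_ext_linear. Qed.

Lemma Delta_linear : linear (@Delta K).
Proof. exact: lin_ext_linear. Qed.

Lemma mul_qp k l (P : qposet k) (Q : qposet l) :
  (<< qp P >> : HQP K) * << qp Q >> = << qp (qsum P Q) >>.
Proof.
apply/malgP => R; rewrite (malgMEw (d1 := [fset qp P]%fset) (d2 := [fset qp Q]%fset)).
- by rewrite !big_seq_fset1 !mcoeffU !eqxx mulr1.
- exact: msuppU_le.
- exact: msuppU_le.
Qed.
Section Sum.
Variables (k l : nat) (P : qposet k) (Q : qposet l).
Let h : 'I_k + 'I_l -> 'I_(k + l) := unsplit.
Let hK : cancel h (@split k l) := @unsplitK k l.
Let hinvK : cancel (@split k l) h := @splitK k l.

Lemma qsum_glue (P1 : qposet k) (Q1 : qposet l) :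
  qsum P1 Q1 = glue (@split k l) P1 Q1.
Proof. by apply: qposet_ext => i j; rewrite qle_glue qsumE. Qed.

Lemma no_descent_sum : no_descent h (qsum P Q).
Proof. by apply/no_descentP => b a; rewrite qsumE !hK. Qed.

(** The classes of a contraction are connected, and no comparison of a
    disjoint union crosses from one summand to the other. *)
Lemma contraction_sum_no_descent E : contraction (qsum P Q) E -> no_descent h E.
Proof.
move=> /contractionP[sE kE aE]; apply/no_descentP => b a; apply/negP => /kE ba.
pose R z := exists c, z = upper_part h c.
suff [c /(can_inj hK)] : R (lower_part h a) by [].
apply: (connect_ind _ _ ba); first by exists b.
move=> _ z _ [c ->] /andP[_]; rewrite -[z]hinvK; case: (split z) => d; last by exists d.
by rewrite !qsumE !hK.
Qed.

Lemma sum_contraction_sum (V : zmodType) (G : qposet (k + l) -> V) :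
  \sum_(E | contraction (qsum P Q) E) G (qquot (qsum P Q) E) =
  \sum_(E1 | contraction P E1) \sum_(E2 | contraction Q E2)
     G (qsum (qquot P E1) (qquot Q E2)).
Proof.
have nS := no_descent_sum.
have p1 : qpull (lower_part h) (qsum P Q) = P by rewrite qsum_glue pull_glue_lower.
have p2 : qpull (upper_part h) (qsum P Q) = Q by rewrite qsum_glue pull_glue_upper.
transitivity (\sum_(E | contraction (qsum P Q) E && no_descent h E)
   G (qsum (qquot P (qpull (lower_part h) E)) (qquot Q (qpull (upper_part h) E)))).
  apply: eq_big => E /=.
    apply/idP/andP => [cE|[]//]; split=> //; exact: contraction_sum_no_descent.
  move=> cE; have nE := contraction_sum_no_descent cE.
  have [sE _ _] := contractionP cE.
  have nQ := no_descent_quot hK hinvK nS nE.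
  have <- : qpull (lower_part h) (qquot (qsum P Q) E) = qquot P (qpull (lower_part h) E).
    by rewrite pull_quot ?p1 //; [apply: lower_inj | apply: lower_convex].
  have <- : qpull (upper_part h) (qquot (qsum P Q) E) = qquot Q (qpull (upper_part h) E).
    by rewrite pull_quot ?p2 //; [apply: upper_inj | apply: upper_convex].
  congr G; rewrite [RHS]qsum_glue glue_pull // => a b.
  apply/negP; rewrite qle_quot => ab; pose R z := exists c, z = lower_part h c.
  suff [c /(can_inj hK)] : R (upper_part h b) by [].
  apply: (connect_ind _ _ ab); first by exists a.
  move=> _ z _ [c ->]; rewrite -[z]hinvK; case: (split z) => d; first by exists d.
  by rewrite qsumE !hK sE (no_descentP h E nE).
rewrite (sum_contraction_split hK hinvK
  (fun E1 E2 => G (qsum (qquot P E1) (qquot Q E2))) nS).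
by rewrite p1 p2.
Qed.

End Sum.

Lemma Theta_mul_qp k l (P : qposet k) (Q : qposet l) :
  Theta ((<< qp P >> : HQP K) * << qp Q >>) = Theta << qp P >> * Theta << qp Q >>.
Proof.
have -> := mul_qp P Q.
rewrite [LHS]ThetaE.
rewrite [LHS](sum_contraction_sum P Q (fun R => << qp R >> : HQP K)).
rewrite [X in _ = X * _]ThetaE.
rewrite [X in _ = _ * X]ThetaE.
rewrite [RHS]big_distrlr.
by apply: eq_bigr => E1 _; apply: eq_bigr => E2 _; rewrite [RHS]mul_qp.
Qed.

Lemma malg_scalerAr (a : K) (x y : HQP K) : x * (a *: y) = a *: (x * y).
Proof.
rewrite (malgMEw (fsubset_refl (msupp x)) (msuppZ_le a y)) malgME scaler_sumr.
apply: eq_bigr => P _; rewrite scaler_sumr; apply: eq_bigr => Q _.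
by apply/malgP => R; rewrite !mcoeffZ !mcoeffU mulrnAr mulrCA.
Qed.

Lemma ThetaM : {morph (@Theta K) : x y / x * y}.
Proof.
move=> x y; move: x.
apply: (linear_eq (f := fun x : HQP K => Theta (x * y)) (g := fun x : HQP K => Theta x * Theta y)).
- by move=> a u v; rewrite mulrDl -scalerAl Theta_linear.
- by move=> a u v; rewrite Theta_linear mulrDl -scalerAl.
move=> P; move: y.
apply: (linear_eq (f := fun y : HQP K => Theta (<< P >> * y))
  (g := fun y : HQP K => Theta << P >> * Theta y)).
- by move=> a u v; rewrite mulrDr malg_scalerAr Theta_linear.
- by move=> a u v; rewrite Theta_linear mulrDr malg_scalerAr.
by case: P => k P [l Q]; apply: Theta_mul_qp.
Qed.
End ThetaMultiplicative.

(** * Compatibility with the coproduct *)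

Section Restriction.
Variables (n : nat) (O : {set 'I_n}).

Definition restriction_split (s : 'I_#|~: O| + 'I_#|O|) : 'I_n :=
  match s with inl a => enum_val a | inr b => enum_val b end.
Local Notation h := restriction_split.

Lemma restriction_split_bij : bijective h.
Proof.
apply: inj_card_bij; last by rewrite card_sum !card_ord addnC cardsC card_ord.
move=> [a|a] [b|b] /= ab.
- by congr inl; apply: enum_val_inj.
- by have := enum_valP a; rewrite ab inE enum_valP.
- by have := enum_valP b; rewrite -ab inE enum_valP.
- by congr inr; apply: enum_val_inj.
Qed.

Lemma pull_lower (P : qposet n) : qpull (lower_part h) P = qstd P (~: O).
Proof. by apply: qposet_ext => i j; rewrite [LHS]qle_pull [RHS]qle_std. Qed.

Lemma pull_upper (P : qposet n) : qpull (upper_part h) P = qstd P O.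
Proof. by apply: qposet_ext => i j; rewrite [LHS]qle_pull [RHS]qle_std. Qed.

Lemma top_no_descent (P : qposet n) : (O \in top P) = no_descent h P.
Proof.
apply/topP/no_descentP => [oO b a|nP i j iO ij].
  apply/negP => /(oO _ _ (enum_valP b)); have := enum_valP a.
  by rewrite inE => /negbTE ->.
apply: contraT => jO; have jO' : j \in ~: O by rewrite inE.
have := nP (enum_rank_in iO i) (enum_rank_in jO' j).
by rewrite /lower_part /upper_part /= !enum_rankK_in // ij.
Qed.

Lemma top_quot (P E : qposet n) : contraction P E -> O \in top P ->
  (O \in top (qquot P E)) = no_descent h E.
Proof.
case: restriction_split_bij => hinv hK hinvK _; rewrite !top_no_descent => nP.
apply/idP/idP => [/no_descentP nQ|]; last exact: (no_descent_quot hK hinvK nP).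
apply/no_descentP => b a; apply/negP => ba; have := nQ b a.
by rewrite (quot_ler _ ba).
Qed.

Lemma top_quot_sub (P E : qposet n) : O \in top (qquot P E) -> O \in top P.
Proof.
by move=> /topP oO; apply/topP => i j iO ij; apply: (oO i) => //; apply: quot_lel.
Qed.

Section Quotient.
Variables (P E : qposet n).
Hypothesis (oO : O \in top (qquot P E)).

Lemma std_quot_lower :
  qstd (qquot P E) (~: O) = qquot (qstd P (~: O)) (qstd E (~: O)).
Proof.
have [hinv hK hinvK] := restriction_split_bij; rewrite -!pull_lower pull_quot //.
  exact: (lower_inj hK).
by apply: (lower_convex hinvK); rewrite -top_no_descent.
Qed.

Lemma std_quot_upper :
  qstd (qquot P E) O = qquot (qstd P O) (qstd E O).
Proof.
have [hinv hK hinvK] := restriction_split_bij; rewrite -!pull_upper pull_quot //.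
  exact: (upper_inj hK).
by apply: (upper_convex hinvK); rewrite -top_no_descent.
Qed.
End Quotient.

Lemma sum_contraction_restrict (V : zmodType) (P : qposet n)
    (G : qposet #|~: O| -> qposet #|O| -> V) : O \in top P ->
  \sum_(E | contraction P E && (O \in top (qquot P E))) G (qstd E (~: O)) (qstd E O) =
  \sum_(E1 | contraction (qstd P (~: O)) E1)
    \sum_(E2 | contraction (qstd P O) E2) G E1 E2.
Proof.
move=> oO; have [hinv hK hinvK] := restriction_split_bij.
have nP : no_descent h P by rewrite -top_no_descent.
rewrite -pull_lower -pull_upper -(sum_contraction_split hK hinvK G nP).
apply: eq_big => E; first by apply: andb_id2l => cE; rewrite top_quot.
by rewrite pull_lower pull_upper.
Qed.

End Restriction.

(** The combinatorial content of the compatibility with the coproduct, for an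
    arbitrary weight G in place of the tensor product: it is used once more in
    the proof of Euler's relation. *)
Lemma sum_contraction_top (V : zmodType) n (P : qposet n)
    (G : forall O : {set 'I_n}, qposet #|~: O| -> qposet #|O| -> V) :
  \sum_(E | contraction P E) \sum_(O in top (qquot P E)) G O (qstd E (~: O)) (qstd E O) =
  \sum_(O in top P) \sum_(E1 | contraction (qstd P (~: O)) E1)
    \sum_(E2 | contraction (qstd P O) E2) G O E1 E2.
Proof.
rewrite (exchange_big_dep (fun O => O \in top P)) /=; last first.
  by move=> E O _; apply: top_quot_sub.
by apply: eq_bigr => O oO; rewrite (sum_contraction_restrict (G O)).
Qed.

Section ThetaComultiplicative.
Variable K : fieldType.

Lemma Theta_comul :
  @Delta K \o Theta =1 (tens_map Theta Theta : HQP2 K -> HQP2 K) \o @Delta K.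
Proof.
apply: (linear_eq (V := HQP2 K)).
- exact: (linear_comp (@Delta_linear K) (@Theta_linear K)).
- exact: (linear_comp (tens_map_linear _ _) (@Delta_linear K)).
case=> n P; rewrite /comp (ThetaE _ P) (DeltaE _ P).
rewrite (linear_bigsum _ _ (@Delta_linear K)) (linear_bigsum _ _ (tens_map_linear _ _)).
transitivity (\sum_(E | contraction P E) \sum_(O in top (qquot P E))
  (<< (qp (qquot (qstd P (~: O)) (qstd E (~: O))), qp (qquot (qstd P O) (qstd E O))) >> : HQP2 K)).
  apply: eq_bigr => E cE; rewrite DeltaE; apply: eq_bigr => O oO.
  exact: (congr2 (fun A B => << (qp A, qp B) >> : HQP2 K)
    (std_quot_lower oO) (std_quot_upper oO)).
rewrite (sum_contraction_top P (fun O E1 E2 =>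
  (<< (qp (qquot (qstd P (~: O)) E1), qp (qquot (qstd P O) E2)) >> : HQP2 K))).
apply: eq_bigr => O oO; rewrite tens_mapU [X in tens X _]ThetaE [X in tens _ X]ThetaE tens_sum.
by apply: eq_bigr => E1 _; apply: eq_bigr => E2 _; rewrite tensUU.
Qed.

End ThetaComultiplicative.

(** * Cancellation in convolution equations *)

Lemma qp_std_setT n (P : qposet n) (A : {set 'I_n}) : A = setT -> qp (qstd P A) = qp P.
Proof.
move=> ->; have cA : #|[set: 'I_n]| = n by rewrite cardsT card_ord.
apply: qp_eq => // i j i' j' ii' jj'; rewrite qle_std.
have ev (a : 'I_#|[set: 'I_n]|) (a' : 'I_n) : a = a' :> nat -> enum_val a = a'.
  move=> aa'; rewrite (enum_val_nth a').
  have -> : enum [set: 'I_n] = enum 'I_n by apply: eq_enum => z; rewrite inE.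
  by apply/val_inj; rewrite aa' -[LHS]/(val (nth a' (enum 'I_n) a')) nth_ord_enum.
by rewrite (ev i i') // (ev j j').
Qed.

Lemma qp_size0 n (P : qposet n) : n = 0 -> qp P = qp_one.
Proof. by move=> n0; apply: qp_eq => // i; have := ltn_ord i; rewrite {2}n0. Qed.

(** The term of the empty open set is the value at P itself and all the other
    terms involve smaller quasi-posets, so the equations determine F by
    induction on the size. The action is trivial for Euler's relation, and is
    the multiplication on the right for the antipode. *)
Lemma convolution_cancel (V : zmodType) (act : QP -> V -> V) (F F' : QP -> V) :
  (forall v, act qp_one v = v) ->
  (forall n (P : qposet n),
     \sum_(O in top P) act (qp (qstd P O)) (F (qp (qstd P (~: O)))) =
     \sum_(O in top P) act (qp (qstd P O)) (F' (qp (qstd P (~: O))))) ->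
  F =1 F'.
Proof.
move=> act1 FF' [n P]; have [m] := ubnP n; elim: m => // m IH in n P *.
rewrite ltnS => nm.
have t0 : set0 \in top P by apply/topP => i j; rewrite inE.
have := FF' n P; rewrite (bigD1 set0) //= [X in _ = X](bigD1 set0) //=.
rewrite (qp_size0 (qstd P set0)) ?cards0 // !act1 qp_std_setT ?setC0 //.
rewrite [X in _ + X = _](eq_bigr (fun O =>
  act (qp (qstd P O)) (F' (qp (qstd P (~: O)))))); first exact: addIr.
move=> O /andP[_ O0]; congr act; apply: IH; apply: leq_trans nm.
by rewrite -[ltnRHS]card_ord -(cardsC O) -[ltnLHS]add0n ltn_add2r card_gt0.
Qed.

(** * Alternating sums over open sets *)

Lemma card_imset_kernel (T : finType) (U V : finType) (D : {set T}) (f : T -> U) (g : T -> V) :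
  {in D &, forall x y, f x = f y <-> g x = g y} -> #|f @: D| = #|g @: D|.
Proof.
have le (U' V' : finType) (f' : T -> U') (g' : T -> V') :
    {in D &, forall x y, f' x = f' y -> g' x = g' y} -> (#|g' @: D| <= #|f' @: D|)%N.
  move=> fg; pose k u := omap g' [pick x in D | f' x == u].
  have sI : injective (@Some V') by move=> a b [].
  rewrite -(card_imset _ sI).
  apply: leq_trans (leq_imset_card k _); apply: subset_leq_card.
  apply/subsetP => _ /imsetP[_ /imsetP[x xD ->] ->]; apply/imsetP.
  exists (f' x); first exact: imset_f.
  rewrite /k; case: pickP => [y /andP[yD /eqP /(fg _ _ yD xD)] /= -> //|/(_ x)].
  by rewrite xD eqxx.
by move=> fg; apply/eqP; rewrite eqn_leq !le // => x y xD yD /fg; apply.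
Qed.

Definition qclass n (P : qposet n) (i : 'I_n) : {set 'I_n} := [set j | qsim P i j].

Lemma qclass_eq n (P : qposet n) i j : qclass P i = qclass P j <-> qsim P i j.
Proof.
split=> [/setP/(_ j)|/andP[ij ji]]; first by rewrite !inE /qsim !qle_refl.
apply/setP => x; rewrite !inE /qsim; apply/andP/andP => -[ix xi]; split;
 by [apply: qle_trans ix|apply: qle_trans xi _].
Qed.

Lemma ncl_std n (P : qposet n) (A : {set 'I_n}) :
  ncl (qsim (qstd P A)) = #|qclass P @: A|.
Proof.
have -> : qclass P @: A = (fun a : 'I_#|A| => qclass P (enum_val a)) @: setT.
  apply/setP => C; apply/imsetP/imsetP => [[i iA ->]|[a _ ->]].
    by exists (enum_rank_in iA i); rewrite ?enum_rankK_in.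
  by exists (enum_val a); rewrite ?enum_valP.
rewrite /ncl /equivalence_partition; apply: card_imset_kernel => a b _ _.
have sE x y : qsim (qstd P A) x y = qsim P (enum_val x) (enum_val y).
  by rewrite /qsim !qle_std.
rewrite qclass_eq -sE -qclass_eq /qclass; split=> [/setP ab|/setP ab]; apply/setP => x;
  by move: (ab x); rewrite !inE.
Qed.

Lemma eq_ncl n (r r' : rel 'I_n) : r =2 r' -> ncl r = ncl r'.
Proof.
move=> rr; rewrite /ncl /equivalence_partition; congr #|pred_of_set _|.
by apply: eq_imset => x; apply/setP => y; rewrite !inE rr.
Qed.

Lemma equiv_stdP n (P : qposet n) (A : {set 'I_n}) :
  reflect {in A &, forall i j, qle P i j -> qle P j i} (is_equiv (qstd P A)).
Proof.
apply: (iffP (qequivP _)) => [sA i j iA jA ij|sA a b].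
  by have := sA (enum_rank_in iA i) (enum_rank_in iA j); rewrite !qle_std !enum_rankK_in // ij.
by rewrite !qle_std; apply/idP/idP; apply: sA; apply: enum_valP.
Qed.

Lemma exists_minimal n (r : rel 'I_n) : reflexive r -> transitive r -> (0 < n)%N ->
  exists i, forall j, r j i -> r i j.
Proof.
move=> rr rt n0; pose i0 := Ordinal n0.
(* Going strictly down would make the set of predecessors smaller. *)
case: (@arg_minnP _ i0 xpredT (fun i => #|[set j | r j i]|) isT) => i _ im.
exists i => j ji; have := im j isT.
have sub : [set k | r k j] \subset [set k | r k i].
  by apply/subsetP => k; rewrite !inE => kj; apply: rt kj ji.
move=> le; have /setP/(_ i) : [set k | r k j] = [set k | r k i].
  by apply/eqP; rewrite eqEcard sub le.
by rewrite !inE rr.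
Qed.

Section Toggle.
Variable K : pzRingType.

(** Toggling the class of i0 is an involution of X that changes the number of
    classes of the complement of O by one. *)
Lemma sum_toggle n (R : qposet n) (i0 : 'I_n) (X : {set {set 'I_n}}) :
  (forall O, O \in X -> [/\ O :|: qclass R i0 \in X, O :\: qclass R i0 \in X &
     forall j, qsim R i0 j -> (j \in O) = (i0 \in O)]) ->
  \sum_(O in X) (-1) ^+ ncl (qsim (qstd R (~: O))) = 0 :> K.
Proof.
set M := qclass R i0 => XP; have iM : i0 \in M by rewrite inE /qsim qle_refl.
(* The members O of X containing i0 are paired with the sets O :\: M, and both
   halves of the sum are indexed by the set that misses M. *)
rewrite (bigID (fun O : {set 'I_n} => i0 \in O)) /=.
rewrite (reindex_onto (fun O => O :|: M) (fun O => O :\: M)) /=; last first.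
  move=> O /andP[/XP[_ _ sat] iO]; apply/setP => j; rewrite !inE.
  by case: (boolP (qsim R i0 j)) => [/sat ->|_]; rewrite ?iO ?orbF.
rewrite [X in _ + X](eq_bigl (fun O => (O :|: M \in X) && (i0 \in O :|: M) &&
    ((O :|: M) :\: M == O))); last first.
  move=> O; rewrite inE iM orbT andbT.
  have -> : ((O :|: M) :\: M == O) = (O :&: M == set0).
    rewrite setDUl setDv setU0; apply/eqP/eqP => [/setDidPl|OM].
      by rewrite -setI_eq0 => /eqP.
    by apply/setDidPl; rewrite -setI_eq0 OM.
  apply/andP/andP => [[OX iO]|[OX /eqP OM]].
    have [uX _ sat] := XP _ OX; split=> //; apply/eqP/setP => j; rewrite !inE.
    by case: (boolP (qsim R i0 j)) => [/sat ->|]; rewrite ?andbF // (negbTE iO).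
  have iO : i0 \notin O by apply/negP => iO; move/setP/(_ i0): OM; rewrite !inE iO /qsim qle_refl.
  have [_ dX _] := XP _ OX; split=> //; move: dX.
  by rewrite setDUl setDv setU0; have /setDidPl -> : [disjoint O & M] by rewrite -setI_eq0 OM.
rewrite -big_split big1 //= => O /andP[_ /eqP OM].
have {OM} dis : [disjoint O & M].
  by rewrite -{}OM -setI_eq0 setDE -setIA [~: M :&: M]setIC setICr setI0.
rewrite !ncl_std.
(* Removing M from O adds exactly one class, M itself, to the complement. *)
have -> : ~: O = M :|: ~: (O :|: M).
  apply/setP => j; rewrite !inE; case: (boolP (qsim R i0 j)) => jM.
    by rewrite (disjointFl dis) // inE.
  by rewrite orbF.
rewrite imsetU cardsU.
have -> : qclass R @: M = [set M].
  apply/setP => C; rewrite inE; apply/imsetP/eqP => [[x]|->]; last by exists i0.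
  by rewrite inE => /qclass_eq <- ->.
have -> : [set M] :&: (qclass R @: (~: (O :|: M))) = set0.
  apply/setP => C; rewrite !inE; apply/negP => /andP[/eqP -> /imsetP[x]].
  by rewrite !inE negb_or => /andP[_ /negP nM] /qclass_eq.
by rewrite cards0 subn0 cards1 exprS mulN1r subrr.
Qed.

(** Any maximal class can be added to, or removed from, an open set on which R
    is symmetric. *)
Lemma sum_top_upper_equiv n (R : qposet n) : (0 < n)%N ->
  \sum_(O in top R | is_equiv (qstd R O)) (-1) ^+ ncl (qsim (qstd R (~: O))) = 0 :> K.
Proof.
move=> n0.
have [||i0 mx] := @exists_minimal n (fun i j => qle R j i) _ _ n0.
- exact: qle_refl.
- by move=> j i k ji kj; apply: (qle_trans kj ji).
pose X := [set O in top R | is_equiv (qstd R O)].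
have XE O : (O \in X) = (O \in top R) && is_equiv (qstd R O) by rewrite [LHS]inE.
rewrite -(eq_bigl _ _ XE).
apply: (sum_toggle (i0 := i0)) => O; rewrite !XE => /andP[]/topP oO /equiv_stdP sO.
have M_up i j : qsim R i0 i -> qle R i j -> qsim R i0 j.
  move=> /andP[i0i ii0] ij; have i0j := qle_trans i0i ij.
  by rewrite /qsim i0j mx.
split.
- apply/andP; split; first apply/topP => i j.
    rewrite !inE => /orP[iO /(oO _ _ iO) ->//|iM /(M_up _ _ iM) ->]; exact: orbT.
  apply/equiv_stdP => i j; rewrite !inE => iX jX ij.
  case/orP: iX => [iO|iM]; first by apply: sO => //; apply: oO ij.
  have /andP[_ ji0] := M_up _ _ iM ij; have /andP[i0i _] := iM.
  exact: qle_trans i0i.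
- apply/andP; split; first apply/topP => i j.
    rewrite !inE => /andP[iM iO] ij; have jO := oO _ _ iO ij; rewrite jO andbT.
    by apply: contra iM => jM; apply: M_up jM _; apply: sO.
  by apply/equiv_stdP => i j; rewrite !inE => /andP[_ iO] /andP[_ jO]; apply: sO.
- move=> j /andP[ij ji]; apply/idP/idP => [jO|iO]; [exact: oO ji|exact: oO ij].
Qed.

(** Dually, any minimal class can be added to, or removed from, a lower set on
    which R is symmetric. *)
Lemma sum_top_lower_equiv n (R : qposet n) : (0 < n)%N ->
  \sum_(O in top R | is_equiv (qstd R (~: O)))
     (-1) ^+ ncl (qsim (qstd R (~: O))) = 0 :> K.
Proof.
move=> n0.
have [||i0 mn] := @exists_minimal n (qle R) _ _ n0.
- exact: qle_refl.
- exact: qle_trans.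
pose X := [set O in top R | is_equiv (qstd R (~: O))].
have XE O : (O \in X) = (O \in top R) && is_equiv (qstd R (~: O)) by rewrite [LHS]inE.
rewrite -(eq_bigl _ _ XE).
apply: (sum_toggle (i0 := i0)) => O; rewrite !XE => /andP[]/topP oO /equiv_stdP sO.
have sO' i j : i \notin O -> j \notin O -> qle R i j -> qle R j i.
  by move=> iO jO; apply: sO; rewrite inE.
have M_down i j : qsim R i0 j -> qle R i j -> qsim R i0 i.
  move=> /andP[i0j ji0] ij; have ii0 := qle_trans ij ji0.
  by rewrite /qsim ii0 mn.
split.
- apply/andP; split; first apply/topP => i j.
    rewrite !inE => /orP[iO /(oO _ _ iO) ->//|iM ij].
    case: (boolP (j \in O)) => //= jO.
    have iO : i \notin O by apply: contra jO => iO; apply: oO ij.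
    have ji := sO' _ _ iO jO ij; exact: M_down iM ji.
  apply/equiv_stdP => i j; rewrite !inE !negb_or => /andP[iO _] /andP[jO _].
  exact: sO'.
- apply/andP; split; first apply/topP => i j.
    rewrite !inE => /andP[iM iO] ij; rewrite (oO _ _ iO ij) andbT.
    by apply: contra iM => jM; apply: M_down ij.
  apply/equiv_stdP => i j; rewrite !inE ![~~ (~~ _ && _)]negb_and !negbK => iX jX ij.
  case/orP: jX => [jM|jO].
    have /andP[i0i _] := M_down _ _ jM ij; have /andP[_ ji0] := jM.
    exact: qle_trans i0i.
  apply: sO' => //; case/orP: iX => // iM.
  have [iO|//] := boolP (i \in O); by rewrite (oO _ _ iO ij) in jO.
- move=> j /andP[ij ji]; apply/idP/idP => [jO|iO]; [exact: oO ji|exact: oO ij].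
Qed.
End Toggle.

(** * Euler's relation for contractions *)

Lemma equiv_strictP n (Q : qposet n) :
  reflect (strictly_increasing Q (fun _ => 0%N)) (is_equiv Q).
Proof.
apply: (iffP (qequivP Q)) => [sQ|[_ sQ] i j].
  by split=> // i j ij _; rewrite sQ.
by apply/idP/idP => ij; apply: sQ.
Qed.

Section FaceSum.
Variable K : fieldType.

(** The contraction with symmetric quotient is the one into connected
    components: this is the uniqueness of the level components for a constant
    map. *)
Lemma sum_components n (P : qposet n) :
  \sum_(E | contraction P E) (is_equiv (qquot P E))%:R = 1 :> K.
Proof.
have w0 : weakly_increasing P (fun _ => 0%N) by [].
have [c0 s0] := level_contraction w0.
rewrite (bigD1 (level_quot P (fun _ => 0%N))) //= (introT (equiv_strictP _) s0).
rewrite big1 ?addr0 // => E /andP[cE /eqP nE].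
by case: equiv_strictP => // /(contraction_level cE)[_ /nE].
Qed.

Lemma sum_qposet0 (V : nmodType) (P : qposet 0) (G : qposet 0 -> V) :
  \sum_(E | contraction P E) G E = G P.
Proof.
have eqP0 (E : qposet 0) : E = P by apply: qposet_ext => -[].
rewrite (big_pred1 P) // => E; rewrite [E]eqP0 /= eqxx.
by apply/contractionP; split; case.
Qed.

Definition face_sum n (P : qposet n) : K :=
  \sum_(E | contraction P E) (-1) ^+ ncl (qle E).

(** The value predicted by Euler's relation: only a linear space, of dimension
    cl(P), contributes. *)
Definition lineality_sign n (P : qposet n) : K :=
  if is_equiv P then (-1) ^+ ncl (qsim P) else 0.

(** Each term F(P restricted to the complement of O) is multiplied by 1,
    written as the number of contractions of P restricted to O with symmetric
    quotient. The sum is then regrouped by contractions of P. *)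
Lemma sum_top_face_sum n (P : qposet n) : (0 < n)%N ->
  \sum_(O in top P) face_sum (qstd P (~: O)) = 0.
Proof.
move=> n0; pose G (O : {set 'I_n}) (E1 : qposet #|~: O|) (E2 : qposet #|O|) : K :=
  (-1) ^+ ncl (qle E1) * (is_equiv (qquot (qstd P O) E2))%:R.
transitivity (\sum_(O in top P) \sum_(E1 | contraction (qstd P (~: O)) E1)
    \sum_(E2 | contraction (qstd P O) E2) G O E1 E2).
  apply: eq_bigr => O _; apply: eq_bigr => E1 _.
  by rewrite -mulr_sumr sum_components mulr1.
rewrite -(sum_contraction_top P G) big1 // => E cE.
rewrite -[RHS](sum_top_upper_equiv K (qquot P E) n0) [RHS]big_mkcondr.
apply: eq_bigr => O oO; rewrite /G -(std_quot_upper oO).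
have -> : ncl (qle (qstd E (~: O))) = ncl (qsim (qstd (qquot P E) (~: O))).
  apply: eq_ncl => i j; rewrite qle_std -(qsim_quot cE).
  by rewrite /qsim !qle_std.
by case: is_equiv; rewrite ?mulr1 ?mulr0.
Qed.

Lemma sum_top_lineality_sign n (P : qposet n) : (0 < n)%N ->
  \sum_(O in top P) lineality_sign (qstd P (~: O)) = 0.
Proof.
by move=> n0; rewrite -[RHS](sum_top_lower_equiv K P n0) [RHS]big_mkcondr; apply: eq_bigr.
Qed.

Lemma face_sum0 n (P : qposet n) : n = 0 -> face_sum P = lineality_sign P.
Proof.
move=> n0; subst n; rewrite /face_sum sum_qposet0 /lineality_sign.
have -> : is_equiv P by apply/qequivP; case.
by congr (_ ^+ _); apply: eq_ncl; case.
Qed.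

(** Euler's relation for the faces of the cone of increasing maps. *)
Lemma face_sumE n (P : qposet n) : face_sum P = lineality_sign P.
Proof.
pose F (P : QP) := face_sum (tagged P); pose F' (P : QP) := lineality_sign (tagged P).
suff FF : F =1 F' by exact: FF (qp P).
apply: (@convolution_cancel K (fun _ v => v)) => // {P}{}n P.
have [n0|n0] := posnP n; last by rewrite sum_top_face_sum // sum_top_lineality_sign.
apply: eq_bigr => O _; apply: face_sum0; apply/eqP.
by rewrite -leqn0 -[X in (_ <= X)%N]n0 -[X in (_ <= X)%N]card_ord max_card.
Qed.

End FaceSum.

(** * The inverse of Theta *)

Definition qsym n (P : qposet n) : qposet n :=
  mk_qposet (r := qsim P)
    (fun x => introT andP (conj (qle_refl P x) (qle_refl P x)))
    (fun y x z (xy : _ && _) (yz : _ && _) =>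
       match elimT andP xy, elimT andP yz with
       | conj p e, conj p' e' => introT andP (conj (qle_trans p p') (qle_trans e' e))
       end).

Lemma qle_sym n (P : qposet n) : qle (qsym P) =2 qsim P.
Proof. exact: qle_mk. Qed.

Lemma quot_qsym n (P : qposet n) : qquot P (qsym P) = P.
Proof.
apply: qposet_ext => i j; apply/idP/idP; last exact: quot_lel.
by apply: quot_sub => // x y; rewrite qle_sym => /andP[].
Qed.

Lemma contraction_qsym n (P : qposet n) : contraction P (qsym P).
Proof.
apply/contractionP; split=> [i j|i j|i j].
- by rewrite !qle_sym /qsim andbC.
- by rewrite qle_sym => /andP[ij ji]; apply: connect1; rewrite /zigzag qle_sym /qsim ij ji.
- by rewrite quot_qsym qle_sym => ij ji; apply/andP.
Qed.

(** If P cut along E is symmetric, then every zigzag in a class of E is a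
    chain of P in both directions, and E is as small as possible. *)
Lemma equiv_meet n (P E : qposet n) : contraction P E ->
  is_equiv (qmeet P E) = (E == qsym P).
Proof.
move=> cE; have [sE kE aE] := contractionP cE.
apply/qequivP/eqP => [sM|-> i j]; last first.
  rewrite !qle_meet !qle_sym /qsim.
  by case: (qle P i j); case: (qle P j i).
apply: qposet_ext => i j; rewrite qle_sym.
apply/idP/andP => [ij|[ij ji]]; last by apply: aE; apply: quot_lel.
have EP x y : qle E x y -> qle P x y.
  move/kE; move: y; apply: connect_ind => [|y z _ xy /andP[yz Pyz]]; first exact: qle_refl.
  apply: (qle_trans xy); case/orP: Pyz => // Pzy.
  have : qle (qmeet P E) z y by rewrite qle_meet Pzy sE.
  by rewrite sM qle_meet => /andP[].
by split; apply: EP; rewrite // sE.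
Qed.

Lemma ncl_qsym n (P : qposet n) : ncl (qle (qsym P)) = ncl (qsim P).
Proof. by apply: eq_ncl; apply: qle_sym. Qed.

Section Inverse.
Variable K : fieldType.

Lemma Theta_invE n (P : qposet n) : Theta_inv (<< qp P >> : HQP K) =
  \sum_(E | contraction P E)
    (-1) ^+ (ncl (qsim P) + ncl (qle E)) *: << qp (qquot P E) >>.
Proof. by rewrite /Theta_inv lin_extU. Qed.

Lemma Theta_inv_linear : linear (@Theta_inv K).
Proof. exact: lin_ext_linear. Qed.

Lemma sum_contraction_below n (P E' : qposet n) : contraction P E' ->
  \sum_(E | contraction P E && qsub E E') (-1) ^+ ncl (qle E) =
  (if E' == qsym P then (-1) ^+ ncl (qsim P) else 0) :> K.
Proof.
move=> cE'; rewrite (eq_bigl (contraction (qmeet P E'))); last first.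
  by move=> E; rewrite contraction_meet.
rewrite -[LHS]/(face_sum K (qmeet P E')) face_sumE /lineality_sign equiv_meet //.
case: eqP => // ->; congr (_ ^+ _); apply: eq_ncl => i j.
rewrite /qsim !qle_meet !qle_sym /qsim.
by case: (qle P i j); case: (qle P j i).
Qed.

(** The common part of the two composites, which differ only in the weight c:
    exchanging the sums groups the terms by the final quotient P/E', whose
    coefficient vanishes by Euler's relation unless P/E' = P. *)
Lemma sum_iterated_contraction n (P : qposet n) (c : qposet n -> K) :
  \sum_(E | contraction P E) \sum_(E' | contraction (qquot P E) E')
    (c E' * (-1) ^+ ncl (qle E)) *: << qp (qquot (qquot P E) E') >> =
  (c (qsym P) * (-1) ^+ ncl (qsim P)) *: << qp P >> :> HQP K.
Proof.
transitivity (\sum_(E | contraction P E) \sum_(E' | contraction P E' && qsub E E')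
    (c E' * (-1) ^+ ncl (qle E)) *: << qp (qquot P E') >> : HQP K).
  apply: eq_bigr => E cE; apply: eq_big => E'; first exact: contraction_quot.
  rewrite (contraction_quot _ cE) => /andP[_ /qsubP EE].
  exact: (congr1 (fun Q => _ *: << qp Q >>) (quot_quot P EE)).
rewrite (exchange_big_dep (contraction P)) /=; last by move=> E E' _ /andP[].
rewrite (bigD1 (qsym P)) ?contraction_qsym //= [X in _ + X]big1 ?addr0.
  rewrite -scaler_suml -mulr_sumr.
  rewrite (sum_contraction_below (contraction_qsym P)) eqxx.
  exact: (congr1 (fun Q => _ *: << qp Q >>) (quot_qsym P)).
move=> E' /andP[cE' nE']; rewrite -scaler_suml -mulr_sumr.
rewrite (eq_bigl (fun E => contraction P E && qsub E E')); last first.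
  by move=> E; rewrite cE'.
by rewrite (sum_contraction_below cE') (negbTE nE') mulr0 scale0r.
Qed.

Lemma ThetaK : cancel (@Theta K) (@Theta_inv K).
Proof.
apply: (linear_eq (V := HQP K)) => //.
  exact: (linear_comp Theta_inv_linear (@Theta_linear K)).
case=> n P; rewrite [X in Theta_inv X](ThetaE K P) (linear_bigsum _ _ Theta_inv_linear).
transitivity (\sum_(E | contraction P E) \sum_(E' | contraction (qquot P E) E')
    ((-1) ^+ ncl (qle E') * (-1) ^+ ncl (qle E)) *: << qp (qquot (qquot P E) E') >> : HQP K).
  apply: eq_bigr => E cE; rewrite [LHS]Theta_invE; apply: eq_bigr => E' _.
  by rewrite (eq_ncl (qsim_quot cE)) -exprD addnC.
by rewrite sum_iterated_contraction ncl_qsym -exprD -signr_odd oddD addbb scale1r.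
Qed.

Lemma Theta_invK : cancel (@Theta_inv K) (@Theta K).
Proof.
apply: (linear_eq (V := HQP K)) => //.
  exact: (linear_comp (@Theta_linear K) Theta_inv_linear).
case=> n P; rewrite [X in Theta X](Theta_invE P) (linear_bigsum _ _ (@Theta_linear K)).
transitivity (\sum_(E | contraction P E) \sum_(E' | contraction (qquot P E) E')
    ((-1) ^+ ncl (qsim P) * (-1) ^+ ncl (qle E)) *: << qp (qquot (qquot P E) E') >> : HQP K).
  apply: eq_bigr => E cE.
  rewrite (linear_scale _ _ (@Theta_linear K)).
  rewrite [X in _ *: X]ThetaE scaler_sumr; apply: eq_bigr => E' _.
  by rewrite -exprD.
by rewrite (sum_iterated_contraction P (fun _ => _)) -exprD -signr_odd oddD addbb scale1r.
Qed.

End Inverse.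

(** * The Ehrhart maps *)

Section Ehrhart.
Variable K : fieldType.

Lemma WsetP n (P : qposet n) (w : pword n) :
  reflect (weakly_increasing P (fun i => w i)) (w \in Wset P).
Proof.
rewrite inE; apply: (iffP forallP) => [wP i j ij|wP i].
  by move: (wP i) => /forallP/(_ j)/implyP/(_ ij).
by apply/forallP => j; apply/implyP; apply: wP.
Qed.

Lemma WstrP n (P : qposet n) (w : pword n) :
  reflect (strictly_increasing P (fun i => w i)) (w \in Wstr P).
Proof.
rewrite [w \in _]inE; apply: (iffP andP) => [[/WsetP wP /forallP sP]|[wP sP]].
  split=> // i j ij wij; move: (sP i) => /forallP/(_ j)/implyP.
  by rewrite ij /= => /(_ _)/andP[] //; apply/eqP/val_inj.
split; first exact/WsetP.
apply/forallP => i; apply/forallP => j; apply/implyP => /andP[ij /eqP wij].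
by rewrite /qsim ij sP // wij.
Qed.

Lemma EHR_linear : linear (@EHR K).
Proof. exact: lin_ext_linear. Qed.

Lemma EHRstr_linear : linear (@EHRstr K).
Proof. exact: lin_ext_linear. Qed.

Lemma EHRE n (P : qposet n) : EHR (<< qp P >> : HQP K) = \sum_(w in Wset P) << pw w >>.
Proof. by rewrite /EHR lin_extU. Qed.

Lemma EHRstrE n (P : qposet n) :
  EHRstr (<< qp P >> : HQP K) = \sum_(w in Wstr P) << pw w >>.
Proof. by rewrite /EHRstr lin_extU. Qed.

(** Each increasing word is strictly increasing on exactly one quotient. *)
Lemma EHRstr_Theta : @EHRstr K \o @Theta K =1 @EHR K.
Proof.
apply: (linear_eq (V := WQSym K)).
- exact: (linear_comp EHRstr_linear (@Theta_linear K)).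
- exact: EHR_linear.
case=> n P; rewrite /comp (ThetaE K P) (linear_bigsum _ _ EHRstr_linear) [RHS]EHRE.
under eq_bigr do rewrite EHRstrE.
rewrite (exchange_big_dep (fun w => w \in Wset P)) /=; last first.
  by move=> E w cE /WstrP /(contraction_level cE)[wP _]; apply/WsetP.
apply: eq_bigr => w /WsetP wP; have [cL sL] := level_contraction wP.
rewrite (big_pred1 (level_quot P (fun i => w i))) // => E; apply/andP/eqP => [[cE /WstrP wE]|->].
  by have [] := contraction_level cE wE.
by split=> //; apply/WstrP.
Qed.

End Ehrhart.

(** * Unit, counit and antipode *)

Section Hopf.
Variable K : fieldType.

Lemma malg1E : 1 = << qp_one >> :> HQP K.
Proof. by []. Qed.

Lemma Theta_size0 (P : qposet 0) : Theta << qp P >> = << qp P >> :> HQP K.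
Proof.
rewrite [LHS]ThetaE (sum_qposet0 P (fun E => << qp (qquot P E) >> : HQP K)).
have -> // : qquot P P = P by apply: qposet_ext => -[].
Qed.

Lemma counit_linear : linear (@counit K : HQP K -> K^o).
Proof. by move=> a x y; rewrite /counit mcoeffD mcoeffZ. Qed.

Lemma Theta_counit (x : HQP K) : counit (Theta x) = counit x.
Proof.
move: x; apply: (linear_eq (V := K^o)).
- exact: (linear_comp counit_linear (@Theta_linear K)).
- exact: counit_linear.
case=> [[|n]] P; first by rewrite [X in counit X](Theta_size0 P).
rewrite [X in counit X](ThetaE K P) (linear_bigsum _ _ counit_linear).
have c0 (Q : qposet n.+1) : counit (<< qp Q >> : HQP K) = 0.
  by rewrite /counit mcoeffU; case: eqP => // /(congr1 tag).
by rewrite [RHS](c0 P) big1.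
Qed.

Lemma mprod_linear : linear (@mprod K).
Proof. exact: lin_ext_linear. Qed.

Lemma mprod_tens (x y : HQP K) : mprod (tens x y) = x * y.
Proof.
move: x; apply: (linear_eq (V := HQP K)).
- exact: (linear_comp mprod_linear (tens_linearl y)).
- by move=> a u v; rewrite mulrDl -scalerAl.
move=> P; move: y; apply: (linear_eq (V := HQP K)).
- exact: (linear_comp mprod_linear (tens_linearr << P >>)).
- by move=> a u v; rewrite mulrDr malg_scalerAr.
by move=> Q; rewrite tensUU /mprod lin_extU.
Qed.

Lemma left_convolutionE (S : HQP K -> HQP K) n (P : qposet n) :
  mprod (tens_map S id (Delta << qp P >>)) =
  \sum_(O in top P) S << qp (qstd P (~: O)) >> * << qp (qstd P O) >>.
Proof.
rewrite [X in tens_map _ _ X]DeltaE (linear_bigsum _ _ (tens_map_linear _ _)).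
rewrite (linear_bigsum _ _ mprod_linear); apply: eq_bigr => O _.
by rewrite tens_mapU mprod_tens.
Qed.

(** The left half of the antipode equations determines a linear map. *)
Lemma left_antipode_unique (S S' : HQP K -> HQP K) : linear S -> linear S' ->
  (forall x, mprod (tens_map S id (Delta x)) = mprod (tens_map S' id (Delta x))) ->
  S =1 S'.
Proof.
move=> SL SL' SS; apply: (linear_eq SL SL').
apply: (@convolution_cancel (HQP K) (fun Q v => v * << Q >>)) => [v|n P].
  by rewrite -malg1E mulr1.
exact: etrans (etrans (esym (left_convolutionE S P)) (SS _)) (left_convolutionE S' P).
Qed.

Lemma tens_tens_map (f g : HQP K -> HQP K) x y : linear f -> linear g ->
  tens_map f g (tens x y) = tens (f x) (g y).
Proof.
move=> fL gL; move: x; apply: (linear_eq (V := HQP2 K)).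
- exact: (linear_comp (tens_map_linear _ _) (tens_linearl _)).
- exact: (linear_comp (tens_linearl _) fL).
move=> P; move: y; apply: (linear_eq (V := HQP2 K)).
- exact: (linear_comp (tens_map_linear _ _) (tens_linearr _)).
- exact: (linear_comp (tens_linearr _) gL).
by move=> Q; rewrite tensUU tens_mapU.
Qed.

Lemma tens_map_comp (f g f' g' : HQP K -> HQP K) z : linear f -> linear g ->
  tens_map f g (tens_map f' g' z) = tens_map (f \o f') (g \o g') z.
Proof.
move=> fL gL; move: z; apply: (linear_eq (V := HQP2 K)).
- exact: (linear_comp (tens_map_linear _ _) (tens_map_linear _ _)).
- exact: tens_map_linear.
by move=> [P Q]; rewrite !tens_mapU [LHS]tens_tens_map.
Qed.

Lemma eq_tens_map (f f' g g' : HQP K -> HQP K) : f =1 f' -> g =1 g' ->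
  tens_map f g =1 tens_map f' g'.
Proof. by move=> ff gg z; apply: eq_bigr => p _; rewrite ff gg. Qed.

Lemma Theta_mprod z : Theta (@mprod K z) = mprod (tens_map Theta Theta z).
Proof.
move: z; apply: (linear_eq (V := HQP K)).
- exact: (linear_comp (@Theta_linear K) mprod_linear).
- exact: (linear_comp mprod_linear (tens_map_linear _ _)).
move=> [P Q]; rewrite tens_mapU mprod_tens -ThetaM.
by congr Theta; rewrite -tensUU mprod_tens.
Qed.

(** The conjugate of S by Theta is again a left convolution inverse of the
    identity, so it equals S. *)
Lemma Theta_antipode (S : HQP K -> HQP K) : is_antipode S ->
  forall x, Theta (S x) = S (Theta x).
Proof.
case=> SL Sl _; suff E : S =1 @Theta_inv K \o S \o @Theta K.
  by move=> x; rewrite [X in Theta X]E /= Theta_invK.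
have TS : linear (S \o @Theta K) := linear_comp SL (@Theta_linear K).
have TST : linear (@Theta_inv K \o S \o @Theta K) := linear_comp (@Theta_inv_linear K) TS.
apply: (left_antipode_unique SL TST) => x; rewrite [LHS]Sl.
apply: (can_inj (@ThetaK K)).
have idL : linear (@id (HQP K)) by [].
have ThL := @Theta_linear K.
have eqST : tens_map Theta Theta (tens_map (@Theta_inv K \o S \o @Theta K) id (Delta x)) =
    tens_map S id (Delta (Theta x)).
  rewrite [LHS](tens_map_comp _ _ _ ThL ThL) [X in _ = tens_map S id X]Theta_comul.
  rewrite [RHS](tens_map_comp _ _ _ SL idL).
  by apply: eq_tens_map => [y|y] //; rewrite [LHS]Theta_invK.
rewrite [RHS]Theta_mprod [X in _ = mprod X]eqST [RHS]Sl [X in _ = X *: _]Theta_counit.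
by rewrite (linear_scale _ _ ThL) malg1E [X in _ *: X = _]Theta_size0.
Qed.

End Hopf.

Theorem proposition42 (K : fieldType) (charK0 : [pchar K] =i pred0) :
  [/\ hopf_automorphism (@Theta K),
      cancel (@Theta K) (@Theta_inv K) /\ cancel (@Theta_inv K) (@Theta K),
      @EHRstr K \o @Theta K =1 @EHR K
    & @EHR K \o @Theta_inv K =1 @EHRstr K].
Proof.
split.
- split.
  + exact: Theta_linear.
  + by exists Theta_inv; [apply: ThetaK | apply: Theta_invK].
  + by rewrite malg1E; apply: Theta_size0.
  + exact: ThetaM.
  + exact: Theta_counit.
  + exact: Theta_comul.
  + exact: Theta_antipode.
- by split; [apply: ThetaK | apply: Theta_invK].
- exact: EHRstr_Theta.
- by move=> x; rewrite /= -EHRstr_Theta /= Theta_invK.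
Qed.
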